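(* Let $\mathcal P$ be a set of probability distributions on $\mathcal Z$ containing a hypercube of distributions of characteristic function $\tilde\psi$ and representatives $P_{[-]}$ and $P_{[+]}$. For any training set size $n\ge1$ and any estimator $\hat g$, we have $$\sup_{P\in\mathcal P}\big\{\mathbb E R(\hat g)-\min_gR(g)\big\}\ge\mathcal S_{\tilde\psi}\big(P_{[+]}^{\otimes n},P_{[-]}^{\otimes n}\big),$$ where the minimum is taken over the space of all prediction functions and $\mathbb E R(\hat g)=\mathbb E_{Z_1^n\sim P^{\otimes n}}R(\hat g_{Z_1^n})=\mathbb E_{Z_1^n\sim P^{\otimes n}}\mathbb E_{(X,Y)\sim P}\,\ell[Y,\hat g_{Z_1^n}(X)]$ is the expected risk of $\hat g$ trained on a sample of size $n$.
   Context: Setting: $\mathcal Z=\mathcal X\times\mathcal Y$; a prediction function is a measurable map $\mathcal X\to\mathcal Y$; the loss is $\ell:\mathcal Y\times\mathcal Y\to\mathbb R$ and $R(g)=\mathbb E_{(X,Y)\sim P}\ell[Y,g(X)]$. An estimator maps a training set $Z_1^n\in\mathcal Z^n$ to a prediction function $\hat g_{Z_1^n}$. All quantities are implicitly assumed measurable and expectations and minima well defined. $P^{\otimes n}$ is the $n$-fold product of $P$. For $p,q_+,q_-,\alpha\in[0,1]$ and $y_1,y_2,y\in\mathcal Y$ let $\varphi_{p,y_1,y_2}(y)=p\,\ell(y_1,y)+(1-p)\ell(y_2,y)$, $\phi_{y_1,y_2}(p)=\inf_{y\in\mathcal Y}\varphi_{p,y_1,y_2}(y)$, and $$\psi_{q_+,q_-,y_1,y_2}(\alpha)=\phi_{y_1,y_2}[\alpha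 q_++(1-\alpha)q_-]-\alpha\phi_{y_1,y_2}(q_+)-(1-\alpha)\phi_{y_1,y_2}(q_-).$$ Hypercube. Let $m\ge1$. Consider $2^m$ probability distributions $P_{\bar\sigma}$ on $\mathcal Z$, $\bar\sigma=(\sigma_1,\dots,\sigma_m)\in\{-,+\}^m$, all with the same first marginal $\mu$ (on $\mathcal X$), such that there exist a partition $\mathcal X_0,\dots,\mathcal X_m$ of $\mathcal X$, functions $h_1,h_2:\mathcal X\setminus\mathcal X_0\to\mathcal Y$ (with $h_1(x)\ne h_2(x)$ for every $x$) and functions $p_+,p_-:\mathcal X\setminus\mathcal X_0\to[0,1]$ such that for $j\in\{1,\dots,m\}$ and $x\in\mathcal X_j$, $$P_{\bar\sigma}(Y=h_1(x)|X=x)=p_{\sigma_j}(x)=1-P_{\bar\sigma}(Y=h_2(x)|X=x),$$ while for $x\in\mathcal X_0$ the law of $Y$ given $X=x$ does not depend on $\bar\sigma$. This family is a hypercube of distributions if $\mu(\mathcal X_j)$ is the same for all $j\in\{1,\dots,m\}$ and the law of $(p_+(X),p_-(X),h_1(X),h_2(X))$ when $X\sim\mu(\cdot\,|\,X\in\mathcal X_j)$ is the same for all $j\in\{1,\dots,m\}$. Characteristic function: for $u\ge0$, $$\tilde\psi(u)=\tfrac12m(u+1)\,\mathbb E_{X\sim\mu}\Big\{\mathbf 1_{X\in\mathcal X_1}\,\psi_{p_+(X),p_-(X),h_1(X),h_2(X)}\Big(\frac u{u+1}\Big)\Big\}.$$ Representatives: let $P_0$ be a distribution on $\mathcal Z$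 with first marginal $\mu$ and $P_0[Y=h_1(x)|X=x]=\frac12=P_0[Y=h_2(x)|X=x]$ for $x\in\mathcal X\setminus\mathcal X_0$. For $\sigma\in\{-,+\}$, $P_{[\sigma]}$ has density with respect to $P_0$ equal to $2p_\sigma(x)$ if $x\in\mathcal X_1,y=h_1(x)$; $2[1-p_\sigma(x)]$ if $x\in\mathcal X_1,y=h_2(x)$; and $1$ otherwise. $f$-similarity: for a concave $f:[0,\infty)\to[0,\infty)$ and probability distributions $\mathbb P,\mathbb Q$ with densities $p,q$ with respect to $(\mathbb P+\mathbb Q)/2$, $\mathcal S_f(\mathbb P,\mathbb Q)=\int_{q>0}f(p/q)\,d\mathbb Q$ (which equals $\int f(\frac{d\mathbb P}{d\mathbb Q})d\mathbb Q$ if $\mathbb P\ll\mathbb Q$).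
   Formalization: Well-definedness of minima is taken to include that, for each hypercube member, some prediction function minimises the conditional risk for almost every x off X_0; this is automatic for standard Borel output spaces, but without it the bound can fail on general measurable spaces. *)

(* Defs.v *)
From HB Require Import structures.
From mathcomp Require Import all_boot all_order all_algebra.
From mathcomp Require Import all_classical all_reals all_analysis.

Set Implicit Arguments.
Unset Strict Implicit.
Unset Printing Implicit Defensive.

Import Order.TTheory GRing.Theory Num.Theory.
Import numFieldNormedType.Exports.

Local Open Scope classical_set_scope.
Local Open Scope ring_scope.

Section iid_sample.
Local Open Scope ereal_scope.
Context d (Z : measurableType d) (R : realType).

Definition tuple_cons n (zw : Z * n.-tuple Z) : n.+1.-tuple Z :=
  [tuple of zw.1 :: zw.2].

Lemma measurable_tuple_cons n : measurable_fun setT (@tuple_cons n).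
Proof. exact: measurable_cons. Qed.

HB.instance Definition _ n :=
  isMeasurableFun.Build _ _ _ _ (@tuple_cons n) (@measurable_tuple_cons n).

(* The law P^{(x) n} of a sample of size n; see power_probabilityE. *)
Fixpoint power_probability (P : probability Z R) n : probability (n.-tuple Z) R :=
  if n is n'.+1 then distribution (P \x power_probability P n') (@tuple_cons n')
  else dirac [tuple].

Lemma power_probabilityE (P : probability Z R) n (A : 'I_n -> set Z) :
  (forall i, measurable (A i)) ->
  power_probability P n [set w | forall i, A i (tnth w i)] =
  \prod_(i < n) P (A i).
Proof.
elim: n A => [|n IH] A mA; first by rewrite big_ord0 /= diracE mem_set// => -[].
rewrite big_ord_recl -IH; last by move=> i; exact: mA.
set B := [set w : n.-tuple Z | _].
have mB : measurable B.
  have -> : B = \bigcap_(i in [set: 'I_n]) ((@tnth n Z ^~ i) @^-1` A (lift ord0 i)).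
    by apply/seteqP; split => w /= Bw i; [move=> _|]; exact: Bw.
  apply: fin_bigcap_measurable => //= i _.
  by rewrite -[X in measurable X]setTI; exact: measurable_tnth.
rewrite /= /distribution /pushforward -product_measure1E//.
congr ((P \x power_probability P n) _).
apply/seteqP; split => -[z w] /=.
  move=> Azw; split; first by have := Azw ord0; rewrite tnth0.
  by move=> i; have := Azw (lift ord0 i); rewrite tnthS.
move=> [Az Bw] i; case: (unliftP ord0 i) => [j|] ->; last by rewrite tnth0.
by rewrite tnthS; exact: Bw.
Qed.

End iid_sample.

Section f_similarity.
Local Open Scope ereal_scope.
Context d (T : measurableType d) (R : realType).
Variables P Q : probability T R.

(* (P + Q) / 2 *)
Definition mean_measure : set T -> \bar R :=
  mscale (2^-1 : R)%:nng%R (measure_add P Q).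

HB.instance Definition _ := Measure.on mean_measure.

Lemma mean_measureT : mean_measure setT = 1.
Proof.
have PQT : measure_add P Q setT = 2%:E.
  transitivity (P setT + Q setT); first exact: measure_addE.
  transitivity (1%:E + 1%:E : \bar R); last by rewrite -EFinD.
  by congr (_ + _); exact: probability_setT.
rewrite /mean_measure /mscale [X in _ * X]PQT /= -EFinM mulVf//.
Qed.

HB.instance Definition _ :=
  Measure_isProbability.Build _ _ _ mean_measure mean_measureT.

Definition mean_density (P' : probability T R) (t : T) : R :=
  fine (Radon_Nikodym_SigmaFinite.f P' mean_measure t).

(* f takes extended values so that it can be applied to a characteristic
   function without knowing beforehand that the latter is finite. *)
Definition f_similarity (f : R -> \bar R) : \bar R :=
  \int[Q]_(t in [set t | (0 < mean_density Q t)%R])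
    f (mean_density P t / mean_density Q t)%R.

End f_similarity.

Section loss.
Context dY (Y : measurableType dY) (R : realType).
Variable l : Y -> Y -> R.

Definition varphi (p : R) (y1 y2 y : Y) : R := p * l y1 y + (1 - p) * l y2 y.

(* inf is 0 on sets that are not bounded below; phi is only used where the
   range is bounded below, which follows from conditional_minimum. *)
Definition phi (y1 y2 : Y) (p : R) : R := inf (range (varphi p y1 y2)).

Definition psi (qp qm : R) (y1 y2 : Y) (a : R) : R :=
  phi y1 y2 (a * qp + (1 - a) * qm)
  - a * phi y1 y2 qp - (1 - a) * phi y1 y2 qm.

End loss.

Section prediction.
Local Open Scope ereal_scope.
Context dX dY (X : measurableType dX) (Y : measurableType dY) (R : realType).
Variable l : Y -> Y -> R.

Definition prediction_function : set (X -> Y) :=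
  [set g | measurable_fun setT g].

Definition risk (P : probability (X * Y)%type R) (g : X -> Y) : \bar R :=
  \int[P]_z (l z.2 (g z.1))%:E.

Definition min_risk (P : probability (X * Y)%type R) : \bar R :=
  ereal_inf [set risk P g | g in prediction_function].

Definition expected_risk (P : probability (X * Y)%type R) n
    (ghat : n.-tuple (X * Y)%type -> X -> Y) : \bar R :=
  \int[power_probability P n]_w risk P (ghat w).

(* The negative part of the loss is integrable, so that no risk is of the form
   +oo - oo or equal to -oo, and the minimal risk is attained and finite. *)
Definition risk_well_defined (P : probability (X * Y)%type R) : Prop :=
  (forall g, prediction_function g ->
     \int[P]_z (Num.max (- l z.2 (g z.1)) 0)%:E < +oo) /\
  (exists g, [/\ prediction_function g, risk P g < +oo &
     forall g', prediction_function g' -> risk P g <= risk P g']).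

Definition measurable_estimator n
    (ghat : n.-tuple (X * Y)%type -> X -> Y) : Prop :=
  measurable_fun setT
    (fun wx : n.-tuple (X * Y)%type * X => ghat wx.1 wx.2).

End prediction.

Section hypercube.
Local Open Scope ereal_scope.
Context dX dY (X : measurableType dX) (Y : measurableType dY) (R : realType).

(* P has first marginal mu, and k is a version of the law of the second
   component given the first. *)
Definition conditional_law (mu : probability X R) (k : R.-pker X ~> Y)
    (P : probability (X * Y)%type R) : Prop :=
  forall A, measurable A -> P A = \int[mu]_x k x (xsection A x).

(* The law of V under mu( . | A). *)
Definition law_given d (T : measurableType d) (mu : probability X R)
    (A : set X) (V : X -> T) (B : set T) : \bar R :=
  mu (A `&` V @^-1` B) * ((fine (mu A))^-1)%:E.

(* Signs are booleans, with true standing for +; the blocks of the partition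
   are Xp 0, ..., Xp m, and the block Xp j.+1 is paired with the j-th sign. *)
Variables (m : nat) (mu : probability X R) (Xp : nat -> set X)
  (h1 h2 : X -> Y) (p : bool -> X -> R).

Record hypercube (P_ : {ffun 'I_m -> bool} -> probability (X * Y)%type R) :
    Prop := {
  hypercube_measurable_block :
    forall i, (i <= m)%N -> measurable (Xp i) ;
  hypercube_trivIset : trivIset [set i | (i <= m)%N] Xp ;
  hypercube_cover : \bigcup_(i in [set i | (i <= m)%N]) Xp i = setT ;
  hypercube_measurable_h1 : measurable_fun (~` Xp 0) h1 ;
  hypercube_measurable_h2 : measurable_fun (~` Xp 0) h2 ;
  hypercube_graph_h1 :
    measurable [set z : X * Y | ~ Xp 0 z.1 /\ z.2 = h1 z.1] ;
  hypercube_graph_h2 :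
    measurable [set z : X * Y | ~ Xp 0 z.1 /\ z.2 = h2 z.1] ;
  hypercube_measurable_p : forall s, measurable_fun (~` Xp 0) (p s) ;
  hypercube_h_neq : forall x, ~ Xp 0 x -> h1 x <> h2 x ;
  hypercube_p01 : forall s x, ~ Xp 0 x -> (0 <= p s x <= 1)%R ;
  hypercube_law :
    exists k : {ffun 'I_m -> bool} -> R.-pker X ~> Y,
    [/\ forall s, conditional_law mu (k s) (P_ s),
        forall s (j : 'I_m) x, Xp j.+1 x ->
          k s x [set h1 x] = (p (s j) x)%:E /\
          k s x [set h2 x] = (1 - p (s j) x)%:E &
        forall s s' x, Xp 0 x -> forall B, measurable B ->
          k s x B = k s' x B] ;
  hypercube_eq_mass :
    forall j j' : 'I_m, mu (Xp j.+1) = mu (Xp j'.+1) ;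
  hypercube_eq_law :
    forall (j j' : 'I_m) (B : set (R * R * Y * Y)%type), measurable B ->
      law_given mu (Xp j.+1) (fun x => (p true x, p false x, h1 x, h2 x)) B =
      law_given mu (Xp j'.+1) (fun x => (p true x, p false x, h1 x, h2 x)) B
}.

Definition characteristic_function (l : Y -> Y -> R) (u : R) : \bar R :=
  (2^-1 * m%:R * (u + 1))%:E *
  \int[mu]_(x in Xp 1)
     (psi l (p true x) (p false x) (h1 x) (h2 x) (u / (u + 1)))%:E.

Definition representative_base (P0 : probability (X * Y)%type R) : Prop :=
  exists2 k : R.-pker X ~> Y, conditional_law mu k P0 &
    forall x, ~ Xp 0 x ->
      k x [set h1 x] = (2^-1)%:E /\ k x [set h2 x] = (2^-1)%:E.

Definition representative_density (s : bool) (z : X * Y) : R :=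
  if `[< Xp 1 z.1 /\ z.2 = h1 z.1 >] then (2 * p s z.1)%R
  else if `[< Xp 1 z.1 /\ z.2 = h2 z.1 >] then (2 * (1 - p s z.1))%R
  else 1%R.

Definition representative (P0 : probability (X * Y)%type R) (s : bool)
    (Ps : probability (X * Y)%type R) : Prop :=
  forall A, measurable A ->
    Ps A = \int[P0]_(z in A) (representative_density s z)%:E.

(* Pointwise counterpart of the attainment of the minimal risk under P_ s: some
   prediction function minimises the conditional risk of Y given X = x, i.e.
   varphi (p (s j) x) (h1 x) (h2 x), for almost all x outside Xp 0. *)
Definition conditional_minimum (l : Y -> Y -> R) (s : {ffun 'I_m -> bool}) :
    Prop :=
  exists2 g, prediction_function g &
    {ae mu, forall x, forall (j : 'I_m) y, Xp j.+1 x ->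
       (varphi l (p (s j) x) (h1 x) (h2 x) (g x) <=
        varphi l (p (s j) x) (h1 x) (h2 x) y)%R}.

End hypercube.

(* Main.v *)
(** Average over a uniform sign vector. With all signs but the j-th fixed, the
    two remaining laws P_-, P_+ differ only on the j-th block, and the sum over
    them of the expected excess risks of an estimator on that block is at least
    the integral, under the n-fold product of P_-, of
    (u + 1) E[1_{X_j} psi(u / (u + 1))] at the likelihood ratio u of the n-fold
    products. Indeed the conditional risk [varphi] is affine in p, so the two
    conditional risks mix into one at an intermediate probability, where [phi]
    bounds it from below.
    The one-sample likelihood ratio is 1 off the block and depends there only on
    (p_+, p_-) and on which of h_1, h_2 is observed, so its law under P_- is the
    same for every block, for every choice of the other signs, and for the
    representatives; by independence so is the law of the n-sample ratio. *)

Require Import Defs.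
From mathcomp Require Import all_boot all_order all_algebra.
From mathcomp Require Import all_classical all_reals all_analysis.
From mathcomp Require Import ring lra.
From mathcomp Require Import measurable_realfun.

Set Implicit Arguments.
Unset Strict Implicit.
Unset Printing Implicit Defensive.

Import Order.TTheory GRing.Theory Num.Theory.
Import numFieldNormedType.Exports.

Local Open Scope classical_set_scope.
Local Open Scope ring_scope.
Local Open Scope ereal_scope.

(** * Integration tools *)

(** Two obstacles shape the argument. The law P_+ need not be absolutely continuous with respect to
    P_-, so the likelihood ratio r enters only through the identity e dP_+ = r dP_-, where e is the
    indicator of the set where P_- does not vanish. This identity passes to n-fold products, it
    determines the quotient of densities in the similarity P_- almost everywhere, and since e is at
    most 1 it costs only an inequality in the right direction. The loss is neither bounded nor of
    constant sign, so risks may be infinite; excess risks are therefore bounded below by integrals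
    of nonnegative functions, and only integrals known to be finite are ever subtracted. The
    argument u / (u + 1) is the posterior probability of the sign + when both signs have prior
    probability 1/2 and the observed likelihood ratio is u. The factor m / 2 comes from summing over
    the m blocks and from the fact that, for a given sign vector and block, only one law of the pair
    is the true one. *)

Section mixture.
Context d1 d2 (T : measurableType d1) (Z : measurableType d2) (R : realType).
Variables (la : {measure set T -> \bar R}) (nu : {measure set Z -> \bar R}).
Variable K : T -> {measure set Z -> \bar R}.
Hypothesis mK : forall U, measurable U -> measurable_fun [set: T] (K ^~ U).
Hypothesis nuE : forall U, measurable U -> nu U = \int[la]_t K t U.

Import HBNNSimple.

Lemma nnsfun_integral_mixture (f : {nnsfun Z >-> R}) :
  \int[nu]_z (f z)%:E = \int[la]_t \int[K t]_z (f z)%:E.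
Proof.
have fE (m : {measure set Z -> \bar R}) : \int[m]_z (f z)%:E =
    \sum_(r \in range f) r%:E * m (f @^-1` [set r]).
  under eq_integral do rewrite fimfunE -fsumEFin//.
  rewrite ge0_integral_fsum//; last 2 first.
  - by move=> r; exact/measurable_EFinP/measurableT_comp.
  - by move=> r z _; rewrite EFinM nnfun_muleindic_ge0.
  apply: eq_fsbigr => r _.
  rewrite (integralZl_indic _ (fun r => f @^-1` [set r]))//; last first.
    by move=> r0; rewrite preimage_nnfun0.
  by rewrite integral_indic// setIT.
under [in RHS]eq_integral do rewrite fE.
rewrite fE ge0_integral_fsum//; last 2 first.
- by move=> r; apply: measurable_funeM; exact: mK.
- move=> r t _; have := mulemu_ge0 (fun r => f @^-1` [set r]).
  by apply; exact: preimage_nnfun0.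
apply: eq_fsbigr => r _; rewrite nuE//.
(* The constant [r] comes out of the integral only when it is nonnegative; a negative [r] is not a
   value of [f], so its preimage is empty and both sides vanish. *)
have [r0|r0] := leP 0%R r.
  by rewrite ge0_integralZl//; exact: mK.
rewrite !integral0_eq ?mule0// => t _.
  by rewrite preimage_nnfun0// measure0 mule0.
by rewrite preimage_nnfun0// measure0.
Qed.

(** Common source of the transfer, disintegration and density formulas below: [K t] will be a Dirac
    mass or zero, a conditional law carried to the fibre over a point, or a multiple of a Dirac
    mass. *)
Lemma ge0_integral_mixture (f : Z -> \bar R) :
  measurable_fun [set: Z] f -> (forall z, 0 <= f z) ->
  \int[nu]_z f z = \int[la]_t \int[K t]_z f z.
Proof.
move=> mf f0; pose f_ := nnsfun_approx measurableT mf.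
have fE (m : {measure set Z -> \bar R}) :
    \int[m]_z f z = limn (fun n => \int[m]_z (f_ n z)%:E).
  rewrite -monotone_convergence//.
  - by apply/eq_integral => z _; apply/esym/cvg_lim => //=; exact: cvg_nnsfun_approx.
  - by move=> n; exact/measurable_EFinP.
  - by move=> n z _; rewrite lee_fin.
  - by move=> z _ a b ab; rewrite lee_fin; exact/lefP/nd_nnsfun_approx.
under [in RHS]eq_integral do rewrite fE.
rewrite fE monotone_convergence//.
- by congr (limn _); apply/funext => n; rewrite nnsfun_integral_mixture.
- move=> n; apply: measurable_fun_integral_kernel => //.
  + by move=> z; rewrite lee_fin.
  + exact/measurable_EFinP.
- by move=> n t _; apply: integral_ge0 => // z _; rewrite lee_fin.
- move=> t _ a b ab; apply: ge0_le_integral => //.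
  + by move=> z _; rewrite lee_fin.
  + exact/measurable_EFinP.
  + exact/measurable_EFinP.
  + by move=> z _; rewrite lee_fin; exact/lefP/nd_nnsfun_approx.
Qed.

End mixture.

(** * Product measures *)

Section power_probability.
Context d (Z : measurableType d) (R : realType).
Implicit Types P Q : probability Z R.

Lemma ge0_integral_power_probability0 P (G : 0.-tuple Z -> \bar R) :
  measurable_fun setT G -> \int[power_probability P 0]_w G w = G [tuple].
Proof. by move=> mG; rewrite integral_dirac// diracT mul1e. Qed.

Lemma ge0_integral_power_probabilityS P n (G : n.+1.-tuple Z -> \bar R) :
  measurable_fun setT G -> (forall w, 0 <= G w) ->
  \int[power_probability P n.+1]_w G w =
  \int[P]_z \int[power_probability P n]_w G (tuple_cons (z, w)).
Proof.
move=> mG G0.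
have mGc := measurableT_comp mG (@measurable_tuple_cons _ Z n).
rewrite [LHS](@ge0_integral_distribution _ _ _ _ _
  (P \x power_probability P n) (@tuple_cons _ Z n) _ mG G0).
by rewrite (fubini_tonelli1 _ mGc)// => zw; exact: G0.
Qed.

Definition tuple_prod (a : Z -> R) n (w : n.-tuple Z) : R :=
  (\prod_(i < n) a (tnth w i))%R.

Lemma tuple_prod0 a (w : 0.-tuple Z) : tuple_prod a w = 1%R.
Proof. by rewrite /tuple_prod big_ord0. Qed.

Lemma tuple_prod_cons a n z (w : n.-tuple Z) :
  tuple_prod a (tuple_cons (z, w)) = (a z * tuple_prod a w)%R.
Proof.
rewrite /tuple_prod big_ord_recl tnth0; congr (_ * _)%R.
by apply: eq_bigr => i _; rewrite tnthS.
Qed.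

Lemma tuple_prod_ge0 a n (w : n.-tuple Z) :
  (forall z, 0 <= a z)%R -> (0 <= tuple_prod a w)%R.
Proof. by move=> a0; apply: prodr_ge0. Qed.

Lemma tuple_prod_le1 a n (w : n.-tuple Z) :
  (forall z, 0 <= a z <= 1)%R -> (tuple_prod a w <= 1)%R.
Proof. by move=> a01; apply: prodr_ile1 => i _; exact: a01. Qed.

Lemma tuple_prod1 n (w : n.-tuple Z) : tuple_prod (fun=> 1%R) w = 1%R.
Proof. by rewrite /tuple_prod big1. Qed.

Lemma measurable_tuple_prod a n : measurable_fun setT a ->
  measurable_fun setT (@tuple_prod a n).
Proof.
move=> ma; apply: measurable_prod => i _.
exact: (measurableT_comp ma (measurable_tnth i)).
Qed.

Lemma measurable_EFin_tuple_prod a n : measurable_fun setT a ->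
  measurable_fun setT (fun w : n.-tuple Z => (tuple_prod a w)%:E).
Proof. by move=> ma; apply/measurable_EFinP; exact: measurable_tuple_prod. Qed.

(** The hypothesis expresses the equality of measures a dP = b dQ, which tensorises without either
    law being absolutely continuous with respect to the other. It is used once with [b] a likelihood
    ratio and once with [b] equal to 1. *)
Lemma integral_power_density P Q (a b : Z -> R) :
  measurable_fun setT a -> measurable_fun setT b ->
  (forall z, 0 <= a z)%R -> (forall z, 0 <= b z)%R ->
  (forall G : Z -> \bar R, measurable_fun setT G -> (forall z, 0 <= G z) ->
    \int[P]_z ((a z)%:E * G z) = \int[Q]_z ((b z)%:E * G z)) ->
  forall n (G : n.-tuple Z -> \bar R),
    measurable_fun setT G -> (forall w, 0 <= G w) ->
  \int[power_probability P n]_w ((tuple_prod a w)%:E * G w) =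
  \int[power_probability Q n]_w ((tuple_prod b w)%:E * G w).
Proof.
move=> ma mb a0 b0 PQ; elim=> [|n IH] G mG G0.
  rewrite !ge0_integral_power_probability0 ?tuple_prod0//.
  - by apply: emeasurable_funM => //; exact: measurable_EFin_tuple_prod.
  - by apply: emeasurable_funM => //; exact: measurable_EFin_tuple_prod.
have mc (c : Z -> R) : measurable_fun setT c ->
    measurable_fun setT (fun w : n.+1.-tuple Z => (tuple_prod c w)%:E * G w).
  move=> mc; apply: emeasurable_funM => //.
  exact: measurable_EFin_tuple_prod.
have mGc := measurableT_comp mG (@measurable_tuple_cons _ Z n).
have mGz z : measurable_fun setT (fun w => G (tuple_cons (z, w))).
  exact: (measurableT_comp mGc (measurable_pair1 z)).
have E P' (c : Z -> R) : measurable_fun setT c -> (forall z, 0 <= c z)%R ->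
   \int[power_probability P' n.+1]_w ((tuple_prod c w)%:E * G w) =
   \int[P']_z ((c z)%:E * \int[power_probability P' n]_w
     ((tuple_prod c w)%:E * G (tuple_cons (z, w)))).
  move=> mc' c0; rewrite ge0_integral_power_probabilityS//; last 2 first.
  - exact: mc.
  - by move=> w; rewrite mule_ge0// lee_fin tuple_prod_ge0.
  apply: eq_integral => z _.
  rewrite -ge0_integralZl//; last 3 first.
  - apply: emeasurable_funM => //.
    exact: measurable_EFin_tuple_prod.
  - by move=> w _; rewrite mule_ge0// lee_fin tuple_prod_ge0.
  - by rewrite lee_fin.
  by apply: eq_integral => w _; rewrite tuple_prod_cons EFinM muleA.
rewrite !E//.
under eq_integral do rewrite IH//.
apply: PQ; last first.
  move=> z; apply: integral_ge0 => w _.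
  by rewrite mule_ge0// lee_fin tuple_prod_ge0.
apply: (measurable_fun_fubini_tonelli_F (m2 := power_probability Q n)
  (fun zw => (tuple_prod b zw.2)%:E * G (tuple_cons zw))).
  apply: emeasurable_funM; last exact: mGc.
  exact: (measurableT_comp (measurable_EFin_tuple_prod mb) measurable_snd).
by move=> zw; rewrite mule_ge0// lee_fin tuple_prod_ge0.
Qed.

End power_probability.

Lemma integral_power_law d d' (Z : measurableType d) (Z' : measurableType d')
    (R : realType) (P : probability Z R) (P' : probability Z' R)
    (r : Z -> R) (r' : Z' -> R) :
  measurable_fun setT r -> measurable_fun setT r' ->
  (forall H : R -> \bar R, measurable_fun setT H -> (forall t, 0 <= H t) ->
    \int[P]_z H (r z) = \int[P']_z H (r' z)) ->
  forall n (H : R -> \bar R), measurable_fun setT H -> (forall t, 0 <= H t) ->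
  \int[power_probability P n]_w H (tuple_prod r w) =
  \int[power_probability P' n]_w H (tuple_prod r' w).
Proof.
move=> mr mr' PP'; elim=> [|n IH] H mH H0.
  rewrite !ge0_integral_power_probability0 ?tuple_prod0//.
  - exact: (measurableT_comp mH (measurable_tuple_prod mr')).
  - exact: (measurableT_comp mH (measurable_tuple_prod mr)).
have mHr c : measurable_fun setT (fun t : R => H (c * t)%R).
  by apply: measurableT_comp mH _; exact: measurable_funM.
rewrite !ge0_integral_power_probabilityS//; last 2 first.
- exact: (measurableT_comp mH (measurable_tuple_prod mr')).
- exact: (measurableT_comp mH (measurable_tuple_prod mr)).
under eq_integral do under eq_integral do rewrite tuple_prod_cons.
under [RHS]eq_integral do under eq_integral do rewrite tuple_prod_cons.
(* The factor of the first observation is absorbed into the test function; this is why the induction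
   runs over all [H]. *)
under eq_integral do rewrite (IH (fun t => H (_ * t)%R))//.
apply: (PP' (fun c => \int[power_probability P' n]_w H (c * tuple_prod r' w)%R)).
  apply: (measurable_fun_fubini_tonelli_F (m2 := power_probability P' n)
    (fun zw : R * n.-tuple Z' => H (zw.1 * tuple_prod r' zw.2)%R)) => //.
  apply: (measurableT_comp mH); apply: measurable_funM => //.
  exact: (measurableT_comp (measurable_tuple_prod mr') measurable_snd).
by move=> c; exact: integral_ge0.
Qed.

(** * Similarity and likelihood ratios *)

Lemma integral_probability_cst d (T : measurableType d) (R : realType)
  (P : probability T R) (k : R) : \int[P]_t k%:E = k%:E.
Proof.
rewrite integral_cst// [X in _ * X](_ : _ = 1) ?mule1//.
exact: probability_setT.
Qed.

(** The lower bound keeps the negative part of [f] below a constant, so its integral is finite and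
    can be moved across the inequality even when [f] or [g] has an infinite integral. Splitting [c]
    into its positive and negative parts leaves only nonnegative terms on both sides. It serves for
    the expected risk, with [c] the minimal risk. *)
Lemma lee_integralDcst d (T : measurableType d) (R : realType)
    (P : probability T R) (c : R) (f g : T -> \bar R) :
  measurable_fun setT f -> measurable_fun setT g -> (forall t, 0 <= g t) ->
  (forall t, c%:E + g t <= f t) ->
  c%:E + \int[P]_t g t <= \int[P]_t f t.
Proof.
move=> mf mg g0 cgf.
have mfp := measurable_funepos mf; have mfn := measurable_funeneg mf.
pose cp := Num.max c 0%R; pose cn := Num.max (- c)%R 0%R.
have cp0 : (0 <= cp)%R by rewrite le_max lexx orbT.
have cn0 : (0 <= cn)%R by rewrite le_max lexx orbT.
have cE : c = (cp - cn)%R.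
  rewrite /cp /cn; case: (leP 0%R c) => c0.
    by rewrite max_r ?oppr_le0// subr0.
  by rewrite max_l ?oppr_ge0 ?ltW// sub0r opprK.
have fn_le t : f^\- t <= cn%:E.
  rewrite funenegE ge_max lee_fin cn0 andbT leeNl.
  apply: le_trans (cgf t); apply: (@le_trans _ _ c%:E); last by rewrite leeDl.
  by rewrite lee_fin cE; lra.
have fn_fin t : f^\- t \is a fin_num.
  by rewrite ge0_fin_numE ?funeneg_ge0// (le_lt_trans (fn_le t))// ltry.
have ifn_le : \int[P]_t f^\- t <= cn%:E.
  rewrite -[leRHS](integral_probability_cst P).
  by apply: ge0_le_integral => // t _; exact: funeneg_ge0.
have ifn_fin : \int[P]_t f^\- t \is a fin_num.
  rewrite ge0_fin_numE ?(le_lt_trans ifn_le) ?ltry//.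
  by apply: integral_ge0 => t _; exact: funeneg_ge0.
have : \int[P]_t (f^\- t + (cp%:E + g t)) <= \int[P]_t (f^\+ t + cn%:E).
  apply: ge0_le_integral => //.
  - by move=> t _; rewrite adde_ge0 ?funeneg_ge0// adde_ge0// lee_fin.
  - by apply: emeasurable_funD => //; exact: emeasurable_funD.
  - exact: emeasurable_funD.
  move=> t _.
  rewrite -leeBrDl//.
  have -> : f^\+ t + cn%:E - f^\- t = f t + cn%:E.
    by rewrite -addeAC [in RHS](funeposneg f).
  apply: (@le_trans _ _ ((c%:E + g t) + cn%:E)); last by rewrite leeD2r.
  rewrite addeAC -EFinD (_ : c + cn = cp)%R//.
  by rewrite cE; lra.
have cpg0 t : 0 <= cp%:E + g t by rewrite adde_ge0// lee_fin.
have mcpg : measurable_fun setT (fun t => cp%:E + g t) by exact: emeasurable_funD.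
rewrite !ge0_integralD//.
rewrite !integral_probability_cst.
rewrite [\int[P]_t f t]integralE => H.
rewrite leeBrDr// -(@leeD2rE _ cn%:E)//.
rewrite (_ : _ + cn%:E = \int[P]_t f^\- t + (cp%:E + \int[P]_t g t))//.
have -> : cp%:E = c%:E + cn%:E by rewrite -EFinD cE subrK.
by rewrite addeAC (addeAC c%:E) addeC.
Qed.

Lemma measurable_fun_div d (T : measurableType d) (R : realType)
    (f g : T -> R) : measurable_fun setT f -> measurable_fun setT g ->
  (forall t, 0 <= g t)%R -> measurable_fun setT (fun t => f t / g t)%R.
Proof.
move=> mf mg g0; apply: measurable_funM => //.
under eq_fun do rewrite -powR_inv1//.
exact: (measurableT_comp (measurable_powR (-1)%R) mg).
Qed.

(** The absolute value makes a function that is controlled only on the half-line measurable on the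
    whole line, and changes nothing at a likelihood ratio. *)
Lemma measurable_fun_norm_comp (R : realType) (f : R -> \bar R) :
  measurable_fun [set u : R | (0 <= u)%R] f ->
  measurable_fun setT (fun u : R => f `|u|%R).
Proof.
move=> mf; apply: (measurable_comp _ _ mf) => //.
  rewrite (_ : [set u : R | _] = `[0%R, +oo[%classic)//.
  by apply/seteqP; split => u /=; rewrite in_itv/= andbT.
by move=> _ [u _ <-] /=.
Qed.

Section f_similarity_ratio.
Context d (T : measurableType d) (R : realType).
Variables (P Q : probability T R) (e r : T -> R).
Hypothesis me : measurable_fun setT e.
Hypothesis mr : measurable_fun setT r.
Hypothesis e01 : forall t, (0 <= e t <= 1)%R.
Hypothesis r0 : forall t, (0 <= r t)%R.
Hypothesis PQ : forall G : T -> \bar R, measurable_fun setT G ->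
  (forall t, 0 <= G t) ->
  \int[P]_t ((e t)%:E * G t) = \int[Q]_t ((r t)%:E * G t).
Hypothesis QQ : forall G : T -> \bar R, measurable_fun setT G ->
  (forall t, 0 <= G t) -> \int[Q]_t ((e t)%:E * G t) = \int[Q]_t G t.

Let M : probability T R := mean_measure P Q.


Let ME A : M A = (2^-1)%:E * (P A + Q A).
Proof.
rewrite /M /= /mean_measure /mscale/=.
by congr (_ * _); exact: measure_addE.
Qed.

Let dom_mean (P' : probability T R) :
  (forall A, measurable A -> M A = 0 -> P' A = 0) ->
  exists2 k : T -> R, [/\ mean_density P Q P' = k, measurable_fun setT k &
     forall t, (0 <= k t)%R] &
   forall G : T -> \bar R, measurable_fun setT G ->
   (forall t, 0 <= G t) -> \int[P']_t G t = \int[M]_t (G t * (k t)%:E).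
Proof.
move=> P'M.
have dom : P' `<< M by apply/null_content_dominatesP => A mA; exact: P'M.
have mf := measurable_int _ (Radon_Nikodym_SigmaFinite.f_integrable dom).
have f0 := Radon_Nikodym_SigmaFinite.f_ge0 dom.
have ffin := Radon_Nikodym_SigmaFinite.f_fin_num dom.
exists (mean_density P Q P').
  split => //.
  - exact: (measurableT_comp (@fine_measurable R setT measurableT) mf).
  - by move=> t; exact/fine_ge0/f0.
move=> G mG G0; rewrite -(Radon_Nikodym_SigmaFinite.change_of_variables dom)//.
by apply: eq_integral => t _; rewrite fineK.
Qed.


Let PM A : measurable A -> M A = 0 -> P A = 0.
Proof.
move=> mA; rewrite ME => /eqP; rewrite mule_eq0 eqe invr_eq0 pnatr_eq0/=.
by rewrite padde_eq0// => /andP[/eqP].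
Qed.

Let QM A : measurable A -> M A = 0 -> Q A = 0.
Proof.
move=> mA; rewrite ME => /eqP; rewrite mule_eq0 eqe invr_eq0 pnatr_eq0/=.
by rewrite padde_eq0// => /andP[_ /eqP].
Qed.

(** The hypotheses say e dP = r dQ and e dQ = dQ. In terms of the densities p and q with respect to
    the mean, they read e p = r q and e q = q, and these hold [Q]-almost everywhere because the mean
    dominates [Q]. As q is nonzero [Q]-almost everywhere, e = 1 and p / q = r there. *)
Lemma f_similarity_ratio (f : R -> \bar R) :
  measurable_fun [set u : R | (0 <= u)%R] f ->
  (forall u, (0 <= u)%R -> 0 <= f u) ->
  f_similarity P Q f = \int[Q]_t f (r t).
Proof.
move=> mf f0; rewrite /f_similarity.
have [p [-> mp p0] Pp] := dom_mean PM.
have [q [-> mq q0] Qq] := dom_mean QM.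
have mfn := measurable_fun_norm_comp mf.
(* Equal integrals over every measurable set force equality almost everywhere for the mean, provided
   that one side is integrable; domination transfers it to [Q]. *)
have aeM (a b : T -> R) : measurable_fun setT a -> measurable_fun setT b ->
    (forall t, 0 <= a t)%R -> (forall t, 0 <= b t)%R ->
    \int[M]_t (a t)%:E <= 1 ->
    (forall A, measurable A -> \int[M]_t ((\1_A t)%:E * (a t)%:E) =
      \int[M]_t ((\1_A t)%:E * (b t)%:E)) ->
    {ae Q, forall t, a t = b t}.
  move=> ma mb a0 b0 a1 ab.
  have [N [mN MN sN]] : ae_eq M setT (EFin \o a) (EFin \o b).
    apply: integral_ae_eq => //.
    - apply/integrableP; split; first exact/measurable_EFinP.
      under eq_integral do rewrite /= ger0_norm//.
      by rewrite (le_lt_trans a1)// ltry.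
    - exact/measurable_EFinP.
    - move=> A _ mA; rewrite integral_mkcond [RHS]integral_mkcond.
      under eq_integral do rewrite epatch_indic muleC.
      under [in RHS]eq_integral do rewrite epatch_indic muleC.
      exact: ab.
  exists N; split => //; first exact: QM.
  by move=> t /= abt; apply: sN => /= /(_ I) [].
have mEI A : measurable A -> measurable_fun setT (fun t : T => (\1_A t : R)%:E).
  by move=> mA; apply/measurable_EFinP; exact: measurable_indic.
have ae1 : {ae Q, forall t, (e t * p t)%R = (r t * q t)%R}.
  apply: aeM.
  - exact: measurable_funM.
  - exact: measurable_funM.
  - by move=> t; rewrite mulr_ge0//; case/andP: (e01 t).
  - by move=> t; rewrite mulr_ge0.
  - under eq_integral do rewrite EFinM.
    rewrite -Pp; last 2 first.
    + exact/measurable_EFinP.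
    + by move=> t; rewrite lee_fin; case/andP: (e01 t).
    rewrite -[leRHS](integral_probability_cst P); apply: ge0_le_integral => //.
    + by move=> t _; rewrite lee_fin; case/andP: (e01 t).
    + exact/measurable_EFinP.
    + by move=> t _; rewrite lee_fin; case/andP: (e01 t).
  - move=> A mA.
    under eq_integral do rewrite EFinM muleA.
    under [in RHS]eq_integral do rewrite EFinM muleA.
    rewrite -Pp; last 2 first.
    + by apply: emeasurable_funM; [exact: mEI|exact/measurable_EFinP].
    + by move=> t; rewrite mule_ge0// lee_fin//; case/andP: (e01 t).
    rewrite -Qq; last 2 first.
    + by apply: emeasurable_funM; [exact: mEI|exact/measurable_EFinP].
    + by move=> t; rewrite mule_ge0// lee_fin.
    under eq_integral do rewrite muleC.
    under [in RHS]eq_integral do rewrite muleC.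
    by apply: PQ => [|t]; [exact: mEI|rewrite lee_fin].
have ae2 : {ae Q, forall t, (e t * q t)%R = q t}.
  apply: aeM => //.
  - exact: measurable_funM.
  - by move=> t; rewrite mulr_ge0//; case/andP: (e01 t).
  - under eq_integral do rewrite EFinM.
    rewrite -Qq; last 2 first.
    + exact/measurable_EFinP.
    + by move=> t; rewrite lee_fin; case/andP: (e01 t).
    rewrite -[leRHS](integral_probability_cst Q); apply: ge0_le_integral => //.
    + by move=> t _; rewrite lee_fin; case/andP: (e01 t).
    + exact/measurable_EFinP.
    + by move=> t _; rewrite lee_fin; case/andP: (e01 t).
  - move=> A mA.
    under eq_integral do rewrite EFinM muleA.
    rewrite -Qq; last 2 first.
    + exact: mEI.
    + by move=> t; rewrite lee_fin.
    rewrite -Qq; last 2 first.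
    + by apply: emeasurable_funM; [exact: mEI|exact/measurable_EFinP].
    + by move=> t; rewrite mule_ge0// lee_fin//; case/andP: (e01 t).
    under eq_integral do rewrite muleC.
    by apply: QQ => [|t]; [exact: mEI|rewrite lee_fin].
have mq0 : measurable [set t | q t = 0%R].
  by rewrite -[X in measurable X]setTI; exact: (mq measurableT [set 0%R]).
(* The [Q]-mass of the zero set of q is the integral of q over that set. *)
have ae3 : {ae Q, forall t, q t != 0%R}.
  exists [set t | q t = 0%R]; split => //; last first.
    by move=> t /= /negP; rewrite negbK => /eqP.
  have := Qq _ (mEI _ mq0); rewrite integral_indic// setIT => ->.
    rewrite integral0_eq// => t _; rewrite indicE.
    have [|] := boolP (t \in _); last by rewrite mul0e.
    by rewrite inE /= => ->; rewrite mule0.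
  by move=> t; rewrite lee_fin.
have mD : measurable [set t | (0 < q t)%R].
  rewrite (_ : [set t | _] = ~` [set t | q t = 0%R]); first exact: measurableC.
  apply/seteqP; split => t /=; rewrite lt_neqAle q0 andbT eq_sym.
    by move=> /eqP.
  by move=> /eqP.
have pq0 t : (0 <= p t / q t)%R by rewrite divr_ge0.
rewrite integral_mkcond; apply: ge0_ae_eq_integral => //.
- apply/(measurable_restrictT _ mD); apply: measurable_funTS.
  rewrite (_ : (fun t => f _) = (fun t => f `|p t / q t|%R)).
    exact: (measurableT_comp mfn (measurable_fun_div mp mq q0)).
  by apply/funext => t; rewrite ger0_norm.
- rewrite (_ : (fun t => f _) = (fun t => f `|r t|%R)).
    exact: (measurableT_comp mfn mr).
  by apply/funext => t; rewrite ger0_norm.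
- by move=> t _; apply: erestrict_ge0 => s _; exact: f0.
- by move=> t _; exact: f0.
apply: filterS3 ae1 ae2 ae3 => t E1 E2 q_neq0 _.
have qt0 : (0 < q t)%R by rewrite lt_neqAle eq_sym q_neq0/=.
rewrite patchE mem_set//=; congr f.
have e1 : e t = 1%R by apply: (mulIf q_neq0); rewrite mul1r.
by move: E1; rewrite e1 mul1r => ->; rewrite mulfK.
Qed.

End f_similarity_ratio.

(** * Two laws that differ on one block *)

Lemma measurable_fun_mem d (T : measurableType d) (A : set T) :
  measurable A -> measurable_fun setT (fun t => t \in A).
Proof.
move=> mA; apply: (measurable_fun_bool true); rewrite setTI.
rewrite (_ : _ @^-1` _ = A)//.
by apply/seteqP; split => t /=; [exact: set_mem|exact: mem_set].
Qed.

Section two_point.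
Context dX dY (X : measurableType dX) (Y : measurableType dY) (R : realType).
Variables (mu : probability X R) (B : set X) (h1 h2 : X -> Y)
  (p : bool -> X -> R).
Hypothesis mB : measurable B.
Hypothesis mp : forall s, measurable_fun setT (p s).
Hypothesis p01 : forall s x, (0 <= p s x <= 1)%R.

Definition block_integral s (G : X * Y -> \bar R) : \bar R :=
  \int[mu]_(x in B)
    ((p s x)%:E * G (x, h1 x) + (1 - p s x)%:E * G (x, h2 x)).

(** The last term refers to [P false] for both values of [s]: this is how the two laws are said to
    agree off the block. Two neighbouring laws of a hypercube and the two representatives both
    satisfy this property, and later arguments use nothing else about them. *)
Definition two_point (P : bool -> probability (X * Y)%type R) : Prop :=
  forall s (G : X * Y -> \bar R), measurable_fun setT G ->
    (forall z, 0 <= G z) ->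
  \int[P s]_z G z =
  block_integral s G + \int[P false]_(z in ~` (fst @^-1` B)) G z.

Let G1 := [set z : X * Y | B z.1 /\ z.2 = h1 z.1].
Let G2 := [set z : X * Y | B z.1 /\ z.2 = h2 z.1].
Hypothesis mG1 : measurable G1.
Hypothesis mG2 : measurable G2.
Hypothesis h12 : forall x, B x -> h1 x <> h2 x.

(* Likelihood ratio of the two laws [P true] and [P false] of [two_point]; it
   is 0 where [P false] vanishes, because [t / 0 = 0]. *)
Definition ratio (z : X * Y) : R :=
  if z \in G1 then (p true z.1 / p false z.1)%R
  else if z \in G2 then ((1 - p true z.1) / (1 - p false z.1))%R else 1%R.

(* Indicator of the set where [P false] does not vanish. *)
Definition ratio_dom (z : X * Y) : R :=
  if z \in G1 then (p false z.1 != 0%R)%:R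
  else if z \in G2 then (p false z.1 != 1%R)%:R else 1%R.

Let p_ge0 s x : (0 <= p s x)%R. Proof. by case/andP: (p01 s x). Qed.

Let pC_ge0 s x : (0 <= 1 - p s x)%R.
Proof. by rewrite subr_ge0; case/andP: (p01 s x). Qed.

Lemma ratio_ge0 z : (0 <= ratio z)%R.
Proof. by rewrite /ratio; do 2?case: ifP => _ //; rewrite divr_ge0. Qed.

Lemma ratio_dom01 z : (0 <= ratio_dom z <= 1)%R.
Proof.
rewrite /ratio_dom; case: ifP => _; first by rewrite ler0n lern1 leq_b1.
by case: ifP => _; rewrite ?ler01 ?lexx// ler0n lern1 leq_b1.
Qed.

Lemma measurable_ratio : measurable_fun setT ratio.
Proof.
have mp1 s : measurable_fun setT (fun z : X * Y => p s z.1).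
  exact: measurableT_comp (mp s) measurable_fst.
apply: measurable_fun_ifT; first exact: measurable_fun_mem.
  exact: measurable_fun_div.
apply: measurable_fun_ifT => //; first exact: measurable_fun_mem.
by apply: measurable_fun_div => //; exact: measurable_funB.
Qed.

Lemma measurable_ratio_dom : measurable_fun setT ratio_dom.
Proof.
have mpc (c : R) : measurable_fun setT (fun z : X * Y => (p false z.1 != c)%:R : R).
  rewrite (_ : (fun z => _) = (fun z : X * Y =>
      if ~~ (p false z.1 == c) then 1%R else 0%R)).
    apply: measurable_fun_ifT => //; apply: measurable_neg.
    apply: measurable_fun_eqr => //.
    exact: measurableT_comp (mp _) measurable_fst.
  by apply/funext => z; case: eqP.
apply: measurable_fun_ifT; [exact: measurable_fun_mem|exact: mpc|].
by apply: measurable_fun_ifT => //; exact: measurable_fun_mem.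
Qed.

Let G1E x : B x -> (x, h1 x) \in G1.
Proof. by move=> Bx; rewrite inE. Qed.

Let G1N x : B x -> ((x, h2 x) \in G1) = false.
Proof.
by move=> Bx; apply/negP; rewrite inE => -[_ /= /esym]; exact: h12.
Qed.

Let G2E x : B x -> (x, h2 x) \in G2.
Proof. by move=> Bx; rewrite inE. Qed.

Let G1C z : (~` (fst @^-1` B)) z -> (z \in G1) = false.
Proof. by move=> Bz; apply/negP; rewrite inE => -[]. Qed.

Let G2C z : (~` (fst @^-1` B)) z -> (z \in G2) = false.
Proof. by move=> Bz; apply/negP; rewrite inE => -[]. Qed.

Variable P : bool -> probability (X * Y)%type R.
Hypothesis PB : two_point P.

Let mEratio : measurable_fun setT (fun z => (ratio z)%:E).
Proof. by apply/measurable_EFinP; exact: measurable_ratio. Qed.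

Let mEratio_dom : measurable_fun setT (fun z => (ratio_dom z)%:E).
Proof. by apply/measurable_EFinP; exact: measurable_ratio_dom. Qed.

Let Eratio_ge0 z : 0 <= (ratio z)%:E.
Proof. by rewrite lee_fin ratio_ge0. Qed.

Let Eratio_dom_ge0 z : 0 <= (ratio_dom z)%:E.
Proof. by rewrite lee_fin; case/andP: (ratio_dom01 z). Qed.

(** On the block this is checked atom by atom. Where [P false] gives no mass to an atom, [ratio_dom]
    removes the mass that [P true] may put there, so both sides vanish. *)
Lemma two_point_density (G : X * Y -> \bar R) :
  measurable_fun setT G -> (forall z, 0 <= G z) ->
  \int[P true]_z ((ratio_dom z)%:E * G z) =
  \int[P false]_z ((ratio z)%:E * G z).
Proof.
move=> mG G0; rewrite !PB; last 4 first.
- exact: emeasurable_funM.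
- by move=> z; rewrite mule_ge0.
- exact: emeasurable_funM.
- by move=> z; rewrite mule_ge0.
congr (_ + _).
  apply: eq_integral => x; rewrite inE => Bx.
  rewrite /ratio /ratio_dom G1E// G1N// G2E//= !muleA -!EFinM.
  congr (_%:E * _ + _%:E * _).
    have [->|q0] := eqVneq (p false x) 0%R; first by rewrite mul0r mulr0.
    by rewrite mulr1 mulrC divfK.
  have [->|q1] := eqVneq (p false x) 1%R; first by rewrite subrr mul0r mulr0.
  by rewrite mulr1 mulrC divfK// subr_eq0 eq_sym.
apply: eq_integral => z; rewrite inE => Bz.
by rewrite /ratio /ratio_dom G1C// G2C.
Qed.

Lemma two_point_dom (G : X * Y -> \bar R) :
  measurable_fun setT G -> (forall z, 0 <= G z) ->
  \int[P false]_z ((ratio_dom z)%:E * G z) = \int[P false]_z G z.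
Proof.
move=> mG G0; rewrite !PB; last 4 first.
- by [].
- by [].
- exact: emeasurable_funM.
- by move=> z; rewrite mule_ge0.
congr (_ + _).
  apply: eq_integral => x; rewrite inE => Bx.
  rewrite /ratio_dom G1E// G1N// G2E//= !muleA -!EFinM.
  congr (_%:E * _ + _%:E * _).
    by have [->|q0] := eqVneq (p false x) 0%R; rewrite ?mulr0 ?mulr1.
  by have [->|q1] := eqVneq (p false x) 1%R; rewrite ?subrr ?mulr0 ?mulr1.
apply: eq_integral => z; rewrite inE => Bz.
by rewrite /ratio_dom G1C// G2C// mul1e.
Qed.

(** The right-hand side involves only the mass of the block and the behaviour of (p_+, p_-) on it,
    not the atoms nor the law off the block. This is what allows the ratio to be compared between
    different blocks and different pairs. *)
Lemma two_point_law (H : R -> \bar R) :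
  measurable_fun setT H -> (forall t, 0 <= H t) ->
  \int[P false]_z H (ratio z) =
  \int[mu]_(x in B) ((p false x)%:E * H (p true x / p false x)%R +
    (1 - p false x)%:E * H ((1 - p true x) / (1 - p false x))%R) +
  H 1%R * (1 - mu B).
Proof.
move=> mH H0; rewrite PB//; last exact: measurableT_comp mH measurable_ratio.
congr (_ + _).
  apply: eq_integral => x; rewrite inE => Bx.
  by rewrite /ratio G1E// G1N// G2E.
have mC : measurable (~` (fst @^-1` B) : set (X * Y)).
  by apply: measurableC; rewrite -[X in measurable X]setTI; exact: measurable_fst.
transitivity (\int[P false]_(z in ~` (fst @^-1` B)) cst (H 1%R) z).
  apply: eq_integral => z; rewrite inE => Bz.
  by rewrite /ratio G1C// G2C.
rewrite integral_cst//; congr (_ * _).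
(* The mass off the block is read off from [two_point] at the constant function 1, whose block part
   is the mass of [B]. *)
have := @PB false (cst 1%:E) (measurable_cst _) (fun=> lee01).
have -> : block_integral false (cst 1%:E) = mu B.
  rewrite /block_integral.
  under eq_integral do rewrite /= !mule1 -EFinD addrC subrK.
  by rewrite integral_cst// mul1e.
rewrite (integral_probability_cst (P false) 1) !integral_cst// !mul1e.
move=> ->; rewrite addeAC subee ?add0e//.
exact: fin_num_measure.
Qed.

End two_point.

Lemma eq_law_integral d d' (X : measurableType d) (T : measurableType d')
    (R : realType) (mu : {measure set X -> \bar R}) (V : X -> T) (A B : set X) :
  measurable_fun setT V -> measurable A -> measurable B ->
  (forall U, measurable U -> mu (A `&` V @^-1` U) = mu (B `&` V @^-1` U)) ->
  forall F : T -> \bar R, measurable_fun setT F -> (forall t, 0 <= F t) ->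
  \int[mu]_(x in A) F (V x) = \int[mu]_(x in B) F (V x).
Proof.
move=> mV mA mB AB F mF F0.
have E (C : set X) (mC : measurable C) : \int[mu]_(x in C) F (V x) =
    \int[pushforward (mrestr mu mC) V]_t F t.
  (* The image under [V] of the restriction of [mu] to [C] is a mixture of Dirac masses at [V x],
     with the zero measure off [C]. *)
  pose K x : {measure set T -> \bar R} :=
    if x \in C then \d_(V x) : {measure set T -> \bar R} else mzero.
  have KE x G : measurable_fun setT G ->
      \int[K x]_t G t = (G \o V) \_ C x.
    move=> mG; rewrite patchE /K; case: ifPn => xC.
      by rewrite integral_dirac// diracT mul1e.
    exact: integral_measure_zero.
  rewrite integral_mkcond (@ge0_integral_mixture _ _ _ _ _ mu _ K)//.
  - by apply: eq_integral => x _; rewrite KE.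
  - move=> U mU; rewrite (_ : (fun x => _) = (fun x => (\1_(C `&` V @^-1` U) x)%:E)).
      apply/measurable_EFinP/measurable_indic; apply: measurableI => //.
      by rewrite -[X in measurable X]setTI; exact: mV.
    apply/funext => x; rewrite indicE in_setI /K.
    have -> : (x \in V @^-1` U) = (V x \in U) by apply/idP/idP; rewrite !inE.
    by case: ifPn => xC //; rewrite diracE.
  - move=> U mU; rewrite /= /pushforward /mrestr/= setIC -integral_indic//; last first.
      by rewrite -[X in measurable X]setTI; exact: mV.
    rewrite integral_mkcond; apply: eq_integral => x _; rewrite patchE /K.
    have -> : (x \in V @^-1` U) = (V x \in U) by apply/idP/idP; rewrite !inE.
    rewrite indicE; case: (boolP (x \in C)) => xC.
      by rewrite /= /dirac indicE; case: ifPn.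
    by case: ifPn.
rewrite !E; apply: eq_measure_integral => U mU _.
by rewrite /= /pushforward /mrestr/= !(setIC (V @^-1` U)) AB.
Qed.

(** * Concavity gap of the minimal conditional risk *)

Section psi.
Context dY (Y : measurableType dY) (R : realType) (l : Y -> Y -> R).
Implicit Types (y : Y) (p q a u : R).

Definition attained q y1 y2 :=
  exists y0, forall y, (varphi l q y1 y2 y0 <= varphi l q y1 y2 y)%R.

(** The bound [b] guards against the default value of [inf] on sets that are not bounded below. *)
Lemma ge_phi q y1 y2 y (b : R) :
  (forall y', b <= varphi l q y1 y2 y')%R ->
  (b <= phi l y1 y2 q <= varphi l q y1 y2 y)%R.
Proof.
move=> bq; have lbq : lbound (range (varphi l q y1 y2)) b.
  by move=> _ [y' _ <-]; exact: bq.
apply/andP; split.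
  by apply: lb_le_inf => //; exists (varphi l q y1 y2 y), y.
by apply: ge_inf; [exists b|exists y].
Qed.

Lemma phi_le_varphi q y1 y2 y :
  attained q y1 y2 -> (phi l y1 y2 q <= varphi l q y1 y2 y)%R.
Proof. by move=> [y0 y0q]; case/andP: (ge_phi y y0q). Qed.

Lemma phi_attained q y1 y2 y0 :
  (forall y, varphi l q y1 y2 y0 <= varphi l q y1 y2 y)%R ->
  phi l y1 y2 q = varphi l q y1 y2 y0.
Proof. by move=> y0q; apply/eqP; rewrite eq_le andbC; exact: ge_phi. Qed.

Lemma varphi_affine p q y1 y2 y a :
  varphi l (a * p + (1 - a) * q) y1 y2 y =
  (a * varphi l p y1 y2 y + (1 - a) * varphi l q y1 y2 y)%R.
Proof. by rewrite /varphi; ring. Qed.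

Lemma psi_bounds p q y1 y2 y a : attained p y1 y2 -> attained q y1 y2 ->
  (0 <= a <= 1)%R ->
  (0 <= psi l p q y1 y2 a <=
    a * (varphi l p y1 y2 y - phi l y1 y2 p) +
    (1 - a) * (varphi l q y1 y2 y - phi l y1 y2 q))%R.
Proof.
move=> pE qE /andP[a0 a1]; rewrite /psi.
set c := (a * p + (1 - a) * q)%R.
(* Attainment is known only at the two end probabilities; this mixture of the end values bounds the
   conditional risk at [c] from below, which gives both the meaning of [phi] at [c] and the
   concavity inequality. *)
have lb y' : (a * phi l y1 y2 p + (1 - a) * phi l y1 y2 q <= varphi l c y1 y2 y')%R.
  rewrite varphi_affine; apply: lerD; apply: ler_wpM2l; rewrite ?subr_ge0//;
  exact: phi_le_varphi.
have /andP[lo hi] := ge_phi y lb.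
rewrite varphi_affine in hi.
by apply/andP; split; lra.
Qed.

(** The weights of [p] and [q] are u / (u + 1) and 1 / (u + 1); multiplying by u + 1 turns them into
    u and 1, the densities of the two laws relative to the second one. Hence the factor u + 1 in the
    characteristic function. *)
Lemma psi_ratio_le p q y1 y2 y u : attained p y1 y2 -> attained q y1 y2 ->
  (0 <= u)%R ->
  ((u + 1) * psi l p q y1 y2 (u / (u + 1)) <=
    (varphi l q y1 y2 y - phi l y1 y2 q) +
    u * (varphi l p y1 y2 y - phi l y1 y2 p))%R.
Proof.
move=> pE qE u0; have u1 : (0 < u + 1)%R by rewrite ltr_wpDl.
have a01 : (0 <= u / (u + 1) <= 1)%R.
  by apply/andP; split; [rewrite divr_ge0// ltW|rewrite ler_pdivrMr// mul1r lerDl].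
have /andP[_ psi_le] := psi_bounds y pE qE a01.
apply: le_trans (ler_wpM2l (ltW u1) psi_le) _.
rewrite le_eqVlt; apply/orP; left; apply/eqP.
by field; rewrite gt_eqF.
Qed.

End psi.

Lemma measurable_fun_integral_param d d' (T : measurableType d)
    (X : measurableType d') (R : realType)
    (mu : {sigma_finite_measure set X -> \bar R}) (B : set X)
    (F : T -> X -> \bar R) :
  measurable B -> measurable_fun setT (fun tx : T * X => F tx.1 tx.2) ->
  (forall t x, 0 <= F t x) ->
  measurable_fun setT (fun t => \int[mu]_(x in B) F t x).
Proof.
move=> mB mF F0.
under eq_fun do rewrite integral_mkcond epatch_indic.
apply: (measurable_fun_fubini_tonelli_F (m2 := mu)
  (fun tx : T * X => F tx.1 tx.2 * (\1_B tx.2)%:E)).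
  apply: emeasurable_funM => //; apply/measurable_EFinP.
  exact: (measurableT_comp (measurable_indic mB) measurable_snd).
by move=> tx; rewrite mule_ge0// lee_fin.
Qed.

Section measurable_loss.
Context dY (Y : measurableType dY) (R : realType) (l : Y -> Y -> R).
Hypothesis hl : measurable_fun [set: Y * Y] (fun yy => l yy.1 yy.2).
Hypothesis hphi : measurable_fun [set q : R * Y * Y | (0 <= q.1.1 <= 1)%R]
  (fun q => phi l q.1.2 q.2 q.1.1).
Context d (T : measurableType d).
Implicit Types (q a : T -> R) (y : T -> Y).

Lemma measurable_fun_varphi q y1 y2 y : measurable_fun setT q ->
  measurable_fun setT y1 -> measurable_fun setT y2 -> measurable_fun setT y ->
  measurable_fun setT (fun t => varphi l (q t) (y1 t) (y2 t) (y t)).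
Proof.
move=> mq m1 m2 my; apply: measurable_funD; apply: measurable_funM.
- exact: mq.
- exact: (measurableT_comp hl (measurable_fun_pair m1 my)).
- exact: measurable_funB.
- exact: (measurableT_comp hl (measurable_fun_pair m2 my)).
Qed.

Lemma measurable_fun_phi q y1 y2 : measurable_fun setT q ->
  measurable_fun setT y1 -> measurable_fun setT y2 ->
  (forall t, 0 <= q t <= 1)%R ->
  measurable_fun setT (fun t => phi l (y1 t) (y2 t) (q t)).
Proof.
move=> mq m1 m2 q01.
apply: (measurable_comp (F := [set q : R * Y * Y | (0 <= q.1.1 <= 1)%R])
  (f := fun q : R * Y * Y => phi l q.1.2 q.2 q.1.1)
  (g := fun t => (q t, y1 t, y2 t))) => //.
- rewrite -[X in measurable X]setTI.
  rewrite (_ : [set q | _] = (fst \o fst) @^-1` `[0%R, 1%R]%classic).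
    by apply: (measurableT_comp measurable_fst measurable_fst).
  by apply/seteqP; split => -[[a b] c] /=; rewrite in_itv.
- by move=> _ [t _ <-] /=; exact: q01.
- by apply: measurable_fun_pair => //; exact: measurable_fun_pair.
Qed.

Lemma measurable_fun_psi q q' y1 y2 a : measurable_fun setT q ->
  measurable_fun setT q' -> measurable_fun setT y1 -> measurable_fun setT y2 ->
  measurable_fun setT a -> (forall t, 0 <= q t <= 1)%R ->
  (forall t, 0 <= q' t <= 1)%R -> (forall t, 0 <= a t <= 1)%R ->
  measurable_fun setT (fun t => psi l (q t) (q' t) (y1 t) (y2 t) (a t)).
Proof.
move=> mq mq' m1 m2 ma q01 q'01 a01.
have m1a : measurable_fun setT (fun t => 1 - a t)%R by exact: measurable_funB.
apply: measurable_funB; first apply: measurable_funB.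
- apply: measurable_fun_phi => //.
    by apply: measurable_funD; exact: measurable_funM.
  move=> t; have /andP[? ?] := q01 t; have /andP[? ?] := q'01 t.
  by have /andP[? ?] := a01 t; apply/andP; split; nra.
- by apply: measurable_funM => //; exact: measurable_fun_phi.
- by apply: measurable_funM => //; exact: measurable_fun_phi.
Qed.

End measurable_loss.

(** * The lower bound for one pair of laws *)

Section two_point_bound.
Context dX dY (X : measurableType dX) (Y : measurableType dY) (R : realType).
Variable l : Y -> Y -> R.
Hypothesis hl : measurable_fun [set: Y * Y] (fun yy => l yy.1 yy.2).
Hypothesis hphi : measurable_fun [set q : R * Y * Y | (0 <= q.1.1 <= 1)%R]
  (fun q => phi l q.1.2 q.2 q.1.1).
Variables (mu : probability X R) (h1 h2 : X -> Y) (p : bool -> X -> R).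
Hypothesis mh1 : measurable_fun setT h1.
Hypothesis mh2 : measurable_fun setT h2.
Hypothesis mp : forall s, measurable_fun setT (p s).
Hypothesis p01 : forall s x, (0 <= p s x <= 1)%R.

(* The truncations at 0 and the absolute values change nothing where it matters:
   the truncated quantities are almost everywhere nonnegative (wherever [phi] is
   attained), and [u] is a likelihood ratio. *)
Definition excess s x y : R :=
  Num.max (varphi l (p s x) (h1 x) (h2 x) y - phi l (h1 x) (h2 x) (p s x))%R 0%R.

Definition psi_pos (u : R) x : R :=
  Num.max (psi l (p true x) (p false x) (h1 x) (h2 x)
    (`|u| / (`|u| + 1))%R) 0%R.

(** The characteristic function without its factor m / 2, on an arbitrary block and extended to all
    real [u]. *)
Definition block_function B (u : R) : \bar R :=
  (`|u| + 1)%R%:E * \int[mu]_(x in B) (psi_pos u x)%:E.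

Lemma norm_ratio01 (u : R) : (0 <= `|u| / (`|u| + 1) <= 1)%R.
Proof.
have u1 : (0 < `|u| + 1)%R by rewrite ltr_wpDl.
by rewrite divr_ge0 ?(ltW u1)//= ler_pdivrMr// mul1r lerDl.
Qed.

Lemma measurable_norm_ratio :
  measurable_fun setT (fun u : R => `|u| / (`|u| + 1))%R.
Proof.
have mn : measurable_fun setT (fun u : R => `|u|)%R by exact: normr_measurable.
apply: measurable_fun_div => //; first exact: measurable_funD.
Qed.

Lemma excess_ge0 s x y : (0 <= excess s x y)%R.
Proof. by rewrite le_max lexx orbT. Qed.

Lemma psi_pos_ge0 (u : R) x : (0 <= psi_pos u x)%R.
Proof. by rewrite le_max lexx orbT. Qed.

Lemma measurable_excess d (T : measurableType d) s (f : T -> X) (g : T -> Y) :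
  measurable_fun setT f -> measurable_fun setT g ->
  measurable_fun setT (fun t => excess s (f t) (g t)).
Proof.
move=> mf mg; apply: measurable_maxr => //; apply: measurable_funB.
  apply: measurable_fun_varphi => //.
  - exact: (measurableT_comp (mp s)).
  - exact: (measurableT_comp mh1).
  - exact: (measurableT_comp mh2).
apply: measurable_fun_phi => //.
- exact: (measurableT_comp (mp s)).
- exact: (measurableT_comp mh1).
- exact: (measurableT_comp mh2).
Qed.

Lemma measurable_psi_pos :
  measurable_fun setT (fun ux : R * X => psi_pos ux.1 ux.2).
Proof.
apply: measurable_maxr => //; apply: measurable_fun_psi => //.
- exact: (measurableT_comp (mp true)).
- exact: (measurableT_comp (mp false)).
- exact: (measurableT_comp mh1).
- exact: (measurableT_comp mh2).
- exact: (measurableT_comp measurable_norm_ratio).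
- by move=> ux; exact: norm_ratio01.
Qed.

Lemma block_function_ge0 B (u : R) : 0 <= block_function B u.
Proof.
rewrite mule_ge0 ?lee_fin ?addr_ge0//.
by apply: integral_ge0 => x _; rewrite lee_fin psi_pos_ge0.
Qed.

Lemma measurable_block_function B : measurable B ->
  measurable_fun setT (block_function B).
Proof.
move=> mB; apply: emeasurable_funM.
  have mn : measurable_fun setT (fun u : R => `|u|)%R by exact: normr_measurable.
  by apply/measurable_EFinP; exact: measurable_funD.
apply: (@measurable_fun_integral_param _ _ _ _ _ _ _
  (fun u x => (psi_pos u x)%:E)) => //.
  by apply/measurable_EFinP; exact: measurable_psi_pos.
by move=> u x; rewrite lee_fin psi_pos_ge0.
Qed.

Variable B : set X.
Hypothesis mB : measurable B.
Hypothesis mG1 : measurable [set z : X * Y | B z.1 /\ z.2 = h1 z.1].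
Hypothesis mG2 : measurable [set z : X * Y | B z.1 /\ z.2 = h2 z.1].
Hypothesis h12 : forall x, B x -> h1 x <> h2 x.
Hypothesis p_attained :
  {ae mu, forall x, B x -> forall s, attained l (p s x) (h1 x) (h2 x)}.

Variable P : bool -> probability (X * Y)%type R.
Hypothesis PB : two_point mu B h1 h2 p P.
Variables (n : nat) (g : n.-tuple (X * Y)%type -> X -> Y).
Hypothesis mg : measurable_estimator g.

Definition block_risk B' s w : \bar R := \int[mu]_(x in B') (excess s x (g w x))%:E.

Let r := @tuple_prod _ _ R (ratio B h1 h2 p) n.
Let e := @tuple_prod _ _ R (ratio_dom B h1 h2 p) n.

Lemma block_risk_ge0 B' s w : 0 <= block_risk B' s w.
Proof. by apply: integral_ge0 => x _; rewrite lee_fin excess_ge0. Qed.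

Lemma measurable_block_risk B' s : measurable B' ->
  measurable_fun setT (block_risk B' s).
Proof.
move=> mB'; apply: (@measurable_fun_integral_param _ _ _ _ _ _ _
  (fun w x => (excess s x (g w x))%:E)) => //.
  by apply/measurable_EFinP; exact: measurable_excess.
by move=> w x; rewrite lee_fin excess_ge0.
Qed.

(** For a fixed sample the prediction [g w x] is the same under both signs, so [psi_ratio_le]
    applies to it at almost every point of the block and is integrated. *)
Lemma block_function_le (u : R) w : (0 <= u)%R ->
  block_function B u <= block_risk B false w + u%:E * block_risk B true w.
Proof.
move=> u0.
have mgw : measurable_fun setT (g w) := measurableT_comp mg (measurable_pair1 w).
have me s : measurable_fun B (fun x => (excess s x (g w x))%:E).
  by apply: measurable_funTS; apply/measurable_EFinP; exact: measurable_excess.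
have mpsi : measurable_fun B (fun x => (psi_pos u x)%:E).
  apply: measurable_funTS; apply/measurable_EFinP.
  exact: (measurableT_comp measurable_psi_pos (measurable_pair1 u)).
have e0 s x : 0 <= (excess s x (g w x))%:E by rewrite lee_fin excess_ge0.
have psi0 x : 0 <= (psi_pos u x)%:E by rewrite lee_fin psi_pos_ge0.
have un0 : 0 <= (`|u| + 1)%R%:E by rewrite lee_fin addr_ge0.
have ue0 x : 0 <= u%:E * (excess true x (g w x))%:E by rewrite mule_ge0// lee_fin.
have mue : measurable_fun B (fun x => u%:E * (excess true x (g w x))%:E).
  exact: measurable_funeM.
rewrite /block_function /block_risk -!ge0_integralZl// -ge0_integralD//.
apply: ae_ge0_le_integral => //.
- by move=> x _; rewrite mule_ge0.
- exact: measurable_funeM.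
- by move=> x _; rewrite adde_ge0.
- exact: emeasurable_funD.
apply: filterS p_attained => x pE Bx; have {}pE := pE Bx.
rewrite -!EFinM -EFinD lee_fin /psi_pos /excess ger0_norm//.
have := psi_ratio_le (g w x) (pE true) (pE false) u0.
have ex0 s : (0 <= varphi l (p s x) (h1 x) (h2 x) (g w x) -
    phi l (h1 x) (h2 x) (p s x))%R by rewrite subr_ge0 phi_le_varphi.
rewrite !(max_l (ex0 _)) max_l//.
have := norm_ratio01 u; rewrite ger0_norm// => a01.
by case/andP: (psi_bounds (g w x) (pE true) (pE false) a01).
Qed.

Lemma two_point_bound :
  \int[power_probability (P false) n]_w block_function B (r w) <=
  \int[power_probability (P false) n]_w block_risk B false w +
  \int[power_probability (P true) n]_w block_risk B true w.
Proof.
have mratio := measurable_ratio mp p01 mG1 mG2.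
have mdom := measurable_ratio_dom mp mG1 mG2.
have dom01 := ratio_dom01 B h1 h2 p.
have ratio0 := ratio_ge0 B h1 h2 p01.
have dom0 z : (0 <= ratio_dom B h1 h2 p z)%R by case/andP: (dom01 z).
have mr : measurable_fun setT r by exact: measurable_tuple_prod.
have me : measurable_fun setT e by exact: measurable_tuple_prod.
have r0 w : (0 <= r w)%R by exact: tuple_prod_ge0.
have e0 w : (0 <= e w)%R by exact: tuple_prod_ge0.
have e1 w : (e w <= 1)%R by exact: tuple_prod_le1.
have mk s : measurable_fun setT (block_risk B s) by exact: measurable_block_risk.
have k0 s w : 0 <= block_risk B s w by exact: block_risk_ge0.
have mrk : measurable_fun setT (fun w => (r w)%:E * block_risk B true w).
  by apply: emeasurable_funM => //; exact/measurable_EFinP.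
have mek : measurable_fun setT (fun w => (e w)%:E * block_risk B true w).
  by apply: emeasurable_funM => //; exact/measurable_EFinP.
apply: (@le_trans _ _ (\int[power_probability (P false) n]_w
    (block_risk B false w + (r w)%:E * block_risk B true w))).
  apply: ge0_le_integral => //.
  - by move=> w _; exact: block_function_ge0.
  - exact: (measurableT_comp (measurable_block_function mB) mr).
  - exact: emeasurable_funD.
  - by move=> w _; exact: block_function_le.
rewrite ge0_integralD//; last by move=> w _; rewrite mule_ge0// lee_fin.
apply: leeD => //.
(* The weight [r] under the power of [P false] becomes the weight [e] under the power of [P true];
   bounding [e] by 1 then restores the risk carried by samples that [P false] cannot produce. *)
rewrite -(integral_power_density mdom mratio dom0 ratio0
  (two_point_density mp p01 mG1 mG2 h12 PB))//.
apply: ge0_le_integral => //.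
- by move=> w _; rewrite mule_ge0// lee_fin.
- by move=> w _; rewrite -[leRHS]mul1e lee_wpmul2r// lee_fin.
Qed.

End two_point_bound.

(** * Hypercubes *)

Section conditional_law.
Context dX dY (X : measurableType dX) (Y : measurableType dY) (R : realType).
Variables (mu : probability X R) (k : R.-pker X ~> Y).
Variable P : probability (X * Y)%type R.
Hypothesis kP : conditional_law mu k P.

Lemma integral_conditional_law (G : X * Y -> \bar R) :
  measurable_fun setT G -> (forall z, 0 <= G z) ->
  \int[P]_z G z = \int[mu]_x \int[k x]_y G (x, y).
Proof.
move=> mG G0.
pose K x : {measure set (X * Y) -> \bar R} :=
  measure_function_pushforward__canonical__measure_function_Measure
    (k x) (@measurable_pair1 _ _ X Y x).
have KE x U : K x U = k x (xsection U x).
  by rewrite /K /= /pushforward xsectionE.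
rewrite (@ge0_integral_mixture _ _ _ _ _ mu P K)//.
- apply: eq_integral => x _.
  by rewrite ge0_integral_pushforward//; exact: measurable_pair1.
- move=> U mU; under eq_fun do rewrite KE.
  by apply: measurable_fun_xsection_finite_kernel; rewrite inE.
- by move=> U mU; rewrite [LHS]kP//; under [RHS]eq_integral do rewrite KE.
Qed.

Lemma integral_conditional_law_in (A : set X) (G : X * Y -> \bar R) :
  measurable A -> measurable_fun setT G -> (forall z, 0 <= G z) ->
  \int[P]_(z in fst @^-1` A) G z = \int[mu]_(x in A) \int[k x]_y G (x, y).
Proof.
move=> mA mG G0.
have mfA : measurable (fst @^-1` A : set (X * Y)).
  by rewrite -[X in measurable X]setTI; exact: measurable_fst.
rewrite integral_mkcond integral_conditional_law; last 2 first.
- by apply/(measurable_restrictT _ mfA); exact: measurable_funTS.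
- by move=> z; apply: erestrict_ge0.
rewrite [RHS]integral_mkcond; apply: eq_integral => x _.
rewrite patchE; case: ifPn => [xA|/negP xA].
  apply: eq_integral => y _; rewrite patchE mem_set//=.
  exact: set_mem.
rewrite integral0_eq// => y _; rewrite patchE memNset//= => Ax.
by apply: xA; rewrite inE.
Qed.

End conditional_law.

Lemma ge0_integral_two_atoms d (Y : measurableType d) (R : realType)
    (k : {measure set Y -> \bar R}) (y1 y2 : Y) (a b : R) : k setT = 1 ->
  measurable [set y1] -> measurable [set y2] -> y1 <> y2 ->
  k [set y1] = a%:E -> k [set y2] = b%:E -> (a + b)%R = 1%R ->
  forall G : Y -> \bar R, measurable_fun setT G -> (forall y, 0 <= G y) ->
  \int[k]_y G y = a%:E * G y1 + b%:E * G y2.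
Proof.
move=> kT m1 m2 y12 k1 k2 ab1 G mG G0.
have dis : [set y1] `&` [set y2] = set0.
  by apply/seteqP; split => // y [/= -> /y12].
have m12 : measurable ([set y1] `|` [set y2]) by exact: measurableU.
have k0 : k (~` ([set y1] `|` [set y2])) = 0.
  have kU : k ([set y1] `|` [set y2]) = 1.
    transitivity (k [set y1] + k [set y2]); first exact: measureU.
    by rewrite k1 k2 -EFinD ab1.
  have kD : k (setT `\` ([set y1] `|` [set y2])) =
      k setT - k (setT `&` ([set y1] `|` [set y2])).
    by apply: measureD => //; rewrite [X in X < _](_ : _ = 1) ?ltry.
  by rewrite -setTD kD setTI kT kU subee.
rewrite (ge0_negligible_integral (measurableC m12))// setTD setCK.
rewrite ge0_integral_setU//; last 2 first.
- exact: measurable_funTS.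
- by apply/disj_setPS; rewrite dis.
have atom y0 : measurable [set y0] ->
    \int[k]_(y in [set y0]) G y = k [set y0] * G y0.
  move=> m0; rewrite (eq_integral (cst (G y0))).
    by rewrite integral_cst// muleC.
  by move=> y; rewrite inE /= => ->.
by rewrite !atom// k1 k2.
Qed.

Lemma ge0_integral_density d (T : measurableType d) (R : realType)
    (P Q : {measure set T -> \bar R}) (f : T -> R) :
  measurable_fun setT f -> (forall t, 0 <= f t)%R ->
  (forall A, measurable A -> P A = \int[Q]_(t in A) (f t)%:E) ->
  forall G : T -> \bar R, measurable_fun setT G -> (forall t, 0 <= G t) ->
  \int[P]_t G t = \int[Q]_t ((f t)%:E * G t).
Proof.
move=> mf f0 PQ G mG G0.
pose K t : {measure set T -> \bar R} :=
  mscale (NngNum (f0 t)) (\d_t : {measure set T -> \bar R}).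
have KE t U : K t U = (f t)%:E * (\1_U t)%:E by rewrite /K /= /mscale/= diracE indicE.
rewrite (@ge0_integral_mixture _ _ _ _ _ Q P K)//.
- apply: eq_integral => t _.
  by rewrite ge0_integral_mscale// integral_dirac// diracT mul1e.
- move=> U mU; under eq_fun do rewrite KE.
  apply: emeasurable_funM; first exact/measurable_EFinP.
  exact/measurable_EFinP/measurable_indic.
- move=> U mU; rewrite PQ// integral_mkcond epatch_indic.
  by under [RHS]eq_integral do rewrite KE.
Qed.

Lemma measurable_patch_cst d d' (T : measurableType d) (T' : measurableType d')
    (D : set T) (t0 : T') (f : T -> T') :
  measurable D -> measurable_fun D f ->
  measurable_fun setT (patch (cst t0) D f).
Proof.
move=> mD mf; apply: measurable_fun_if => //; first exact: measurable_fun_mem.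
rewrite setTI (_ : _ @^-1` _ = D)//.
by apply/seteqP; split => t /=; [exact: set_mem|exact: mem_set].
Qed.

Lemma ge0_integral_setC d (T : measurableType d) (R : realType)
    (mu : {measure set T -> \bar R}) (D : set T) (f : T -> \bar R) :
  measurable D -> measurable_fun setT f -> (forall t, 0 <= f t) ->
  \int[mu]_t f t = \int[mu]_(t in D) f t + \int[mu]_(t in ~` D) f t.
Proof.
move=> mD mf f0; rewrite -[in LHS](setUv D) ge0_integral_setU//.
- exact: measurableC.
- by rewrite setUv.
- by apply/disj_setPCl.
Qed.

Definition upd m (s : {ffun 'I_m -> bool}) (j : 'I_m) (b : bool) :
  {ffun 'I_m -> bool} := [ffun i => if i == j then b else s i].

Section hypercube_two_point.
Context dX dY (X : measurableType dX) (Y : measurableType dY) (R : realType).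
Variables (m : nat) (mu : probability X R) (Xp : nat -> set X)
  (h1 h2 : X -> Y) (p : bool -> X -> R).
Variable P_ : {ffun 'I_m -> bool} -> probability (X * Y)%type R.
Hypothesis hcube : hypercube mu Xp h1 h2 p P_.
Variable y0 : Y.

(* [h1], [h2] and [p] are only constrained outside [Xp 0]; these total
   extensions are measurable everywhere. *)
Definition atom1 : X -> Y := patch (cst y0) (~` Xp 0) h1.
Definition atom2 : X -> Y := patch (cst y0) (~` Xp 0) h2.
Definition weight (s : bool) : X -> R := patch (cst 0%R) (~` Xp 0) (p s).

Lemma measurable_block i : (i <= m)%N -> measurable (Xp i).
Proof. exact: (hypercube_measurable_block hcube). Qed.

Lemma measurable_off_block0 : measurable (~` Xp 0).
Proof. by apply: measurableC; exact: measurable_block. Qed.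

Lemma measurable_atom1 : measurable_fun setT atom1.
Proof.
apply: measurable_patch_cst; first exact: measurable_off_block0.
exact: (hypercube_measurable_h1 hcube).
Qed.

Lemma measurable_atom2 : measurable_fun setT atom2.
Proof.
apply: measurable_patch_cst; first exact: measurable_off_block0.
exact: (hypercube_measurable_h2 hcube).
Qed.

Lemma measurable_weight s : measurable_fun setT (weight s).
Proof.
apply: measurable_patch_cst; first exact: measurable_off_block0.
exact: (hypercube_measurable_p hcube).
Qed.

Lemma weight01 s x : (0 <= weight s x <= 1)%R.
Proof.
rewrite /weight /patch; case: ifPn => [|_]; last by rewrite lexx ler01.
by rewrite inE => x0; exact: (hypercube_p01 hcube).
Qed.

Lemma block_disjoint i i' x : (i <= m)%N -> (i' <= m)%N ->
  Xp i x -> Xp i' x -> i = i'.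
Proof.
move=> im i'm xi xi'; apply: (hypercube_trivIset hcube) => //.
by exists x.
Qed.

Lemma off_block0 (j : 'I_m) x : Xp j.+1 x -> ~ Xp 0 x.
Proof.
by move=> xj x0; have := block_disjoint (ltn_ord j) (leq0n m) xj x0.
Qed.

Lemma atom1E x : ~ Xp 0 x -> atom1 x = h1 x.
Proof. by move=> x0; rewrite /atom1 /patch mem_set. Qed.

Lemma atom2E x : ~ Xp 0 x -> atom2 x = h2 x.
Proof. by move=> x0; rewrite /atom2 /patch mem_set. Qed.

Lemma weightE s x : ~ Xp 0 x -> weight s x = p s x.
Proof. by move=> x0; rewrite /weight /patch mem_set. Qed.

Lemma atom12 (j : 'I_m) x : Xp j.+1 x -> atom1 x <> atom2 x.
Proof.
by move=> /off_block0 x0; rewrite atom1E// atom2E//; exact: hypercube_h_neq hcube _ x0.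
Qed.

Lemma measurable_graph1 (j : 'I_m) :
  measurable [set z : X * Y | Xp j.+1 z.1 /\ z.2 = atom1 z.1].
Proof.
have mB : measurable (fst @^-1` Xp j.+1 : set (X * Y)).
  rewrite -[X in measurable X]setTI; apply: measurable_fst => //.
  exact: measurable_block (ltn_ord j).
have := measurableI _ _ mB (hypercube_graph_h1 hcube).
congr measurable; apply/seteqP; split => z /=.
  by move=> [zj [z0 ->]]; rewrite atom1E.
by move=> [zj ->]; have z0 := off_block0 zj; rewrite atom1E.
Qed.

Lemma measurable_graph2 (j : 'I_m) :
  measurable [set z : X * Y | Xp j.+1 z.1 /\ z.2 = atom2 z.1].
Proof.
have mB : measurable (fst @^-1` Xp j.+1 : set (X * Y)).
  rewrite -[X in measurable X]setTI; apply: measurable_fst => //.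
  exact: measurable_block (ltn_ord j).
have := measurableI _ _ mB (hypercube_graph_h2 hcube).
congr measurable; apply/seteqP; split => z /=.
  by move=> [zj [z0 ->]]; rewrite atom2E.
by move=> [zj ->]; have z0 := off_block0 zj; rewrite atom2E.
Qed.

(** Singletons need not be measurable in a general [Y]; this one is a section of the measurable
    graph of [h1]. *)
Lemma measurable_set1_h1 x : ~ Xp 0 x -> measurable [set h1 x].
Proof.
move=> x0; have := measurable_xsection x (hypercube_graph_h1 hcube).
congr measurable; rewrite /xsection; apply/seteqP; split => y /=.
  by rewrite inE => -[].
by move=> ->; rewrite inE.
Qed.

Lemma measurable_set1_h2 x : ~ Xp 0 x -> measurable [set h2 x].
Proof.
move=> x0; have := measurable_xsection x (hypercube_graph_h2 hcube).
congr measurable; rewrite /xsection; apply/seteqP; split => y /=.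
  by rewrite inE => -[].
by move=> ->; rewrite inE.
Qed.

Lemma integral_two_atoms_off_block0 (k : {measure set Y -> \bar R}) x (a : R) :
  k setT = 1 -> ~ Xp 0 x -> k [set h1 x] = a%:E -> k [set h2 x] = (1 - a)%:E ->
  forall G : Y -> \bar R, measurable_fun setT G -> (forall y, 0 <= G y) ->
  \int[k]_y G y = a%:E * G (atom1 x) + (1 - a)%:E * G (atom2 x).
Proof.
move=> kT x0 k1 k2 G mG G0; rewrite atom1E// atom2E//.
apply: ge0_integral_two_atoms => //.
- exact: measurable_set1_h1.
- exact: measurable_set1_h2.
- exact: hypercube_h_neq hcube _ x0.
- by rewrite addrC subrK.
Qed.

Lemma two_atoms_measure (k k' : {measure set Y -> \bar R}) x (a : R) A :
  k setT = 1 -> k' setT = 1 -> measurable A -> ~ Xp 0 x ->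
  k [set h1 x] = a%:E -> k [set h2 x] = (1 - a)%:E ->
  k' [set h1 x] = a%:E -> k' [set h2 x] = (1 - a)%:E -> k A = k' A.
Proof.
move=> kT kT' mA x0 k1 k2 k1' k2'.
have mI : measurable_fun setT (fun y => (\1_A y : R)%:E).
  exact/measurable_EFinP/measurable_indic.
have I0 y : 0 <= (\1_A y : R)%:E by rewrite lee_fin.
have := integral_two_atoms_off_block0 kT x0 k1 k2 mI I0.
rewrite -(integral_two_atoms_off_block0 kT' x0 k1' k2' mI I0).
by rewrite !integral_indic// !setIT.
Qed.

(** The vectors [upd s j b] and [upd s j false] share all signs but the j-th, so off the j-th block
    the conditional laws coincide pointwise: on [Xp 0] by assumption, on any other block because
    they have the same two atoms with the same weights. *)
Lemma hypercube_two_point s (j : 'I_m) :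
  two_point mu (Xp j.+1) atom1 atom2 weight (fun b => P_ (upd s j b)).
Proof.
have [k [kP katoms k0]] := hypercube_law hcube.
have mB : measurable (Xp j.+1) := measurable_block (ltn_ord j).
have mfB : measurable (fst @^-1` Xp j.+1 : set (X * Y)).
  by rewrite -[X in measurable X]setTI; exact: measurable_fst.
move=> b G mG G0; rewrite (ge0_integral_setC _ mfB)//; congr (_ + _).
  rewrite (integral_conditional_law_in (kP _))//; apply: eq_integral => x.
  rewrite inE => Bx; have x0 := off_block0 Bx.
  have [k1 k2] := katoms (upd s j b) j x Bx.
  have mGx : measurable_fun setT (fun y => G (x, y)).
    exact: (measurableT_comp mG (measurable_pair1 x)).
  rewrite (integral_two_atoms_off_block0 (prob_kernel x) x0 k1 k2 mGx)//.
  by rewrite /upd ffunE eqxx weightE.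
apply: eq_measure_integral => A mA AB.
rewrite [LHS]kP// [RHS]kP//; apply: eq_integral => x _.
have [Bx|Bx] := pselect (Xp j.+1 x).
  (* [A] avoids the cylinder over the block, so its section over a point of the block is empty. *)
  rewrite (_ : xsection A x = set0) ?measure0//.
  apply/seteqP; split => // y; rewrite /xsection /= inE => /AB.
  exact.
have mAx := measurable_xsection x mA.
have [i /= im xi] : (\bigcup_(i in [set i | (i <= m)%N]) Xp i) x.
  by rewrite (hypercube_cover hcube).
case: i im xi => [|i] im xi; first exact: k0.
pose o := Ordinal im; have [k1 k2] := katoms (upd s j b) o x xi.
have [k1' k2'] := katoms (upd s j false) o x xi.
apply: (two_atoms_measure (prob_kernel x) (prob_kernel x) mAx (@off_block0 o x xi) k1 k2).
all: have oj : (o == j) = false by apply/negbTE/eqP => oj; apply: Bx; rewrite -oj.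
all: by rewrite ?k1' ?k2' !ffunE oj.
Qed.

Variables (P0 : probability (X * Y)%type R)
  (Ps : bool -> probability (X * Y)%type R).
Hypothesis hm : (1 <= m)%N.
Hypothesis hP0 : representative_base mu Xp h1 h2 P0.
Hypothesis hPs : forall s, representative Xp h1 h2 p P0 s (Ps s).

Let j0 : 'I_m := Ordinal hm.

Lemma representative_densityE s z : representative_density Xp h1 h2 p s z =
  (if z \in [set z : X * Y | Xp 1 z.1 /\ z.2 = atom1 z.1] then 2 * weight s z.1
   else if z \in [set z : X * Y | Xp 1 z.1 /\ z.2 = atom2 z.1]
     then 2 * (1 - weight s z.1) else 1)%R.
Proof.
rewrite /representative_density; have [z1|z1] := pselect (Xp 1 z.1); last first.
  by rewrite !asboolF ?memNset// => -[].
have z0 := @off_block0 j0 _ z1.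
have inA (A : set (X * Y)) : (z \in A) = `[< A z >].
  by apply/idP/asboolP; rewrite inE.
by rewrite !inA /= weightE// atom1E// atom2E.
Qed.

Lemma representative_density_ge0 s z :
  (0 <= representative_density Xp h1 h2 p s z)%R.
Proof.
rewrite representative_densityE; have /andP[w0 w1] := weight01 s z.1.
by case: ifP => _; [|case: ifP => _//]; rewrite mulr_ge0// subr_ge0.
Qed.

Lemma measurable_representative_density s :
  measurable_fun setT (representative_density Xp h1 h2 p s).
Proof.
have mw : measurable_fun setT (fun z : X * Y => weight s z.1).
  exact: measurableT_comp (measurable_weight s) measurable_fst.
rewrite (funext (representative_densityE s)).
apply: measurable_fun_ifT.
- by apply: measurable_fun_mem; exact: (measurable_graph1 j0).
- exact: measurable_funM.
apply: measurable_fun_ifT => //.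
- by apply: measurable_fun_mem; exact: (measurable_graph2 j0).
- by apply: measurable_funM => //; exact: measurable_funB.
Qed.

(** Under [P0] each atom has conditional mass 1/2, which cancels the factor 2 of the density and
    leaves the weights p_s and 1 - p_s on the first block. Elsewhere the density is 1, so both
    representatives agree with [P0]. They thus behave like a hypercube pair without having to belong
    to the hypercube. *)
Lemma representative_two_point :
  two_point mu (Xp 1) atom1 atom2 weight Ps.
Proof.
have [k kP0 katoms] := hP0.
have mB : measurable (Xp 1) := measurable_block hm.
have mfB : measurable (fst @^-1` Xp 1 : set (X * Y)).
  by rewrite -[X in measurable X]setTI; exact: measurable_fst.
have dens s G : measurable_fun setT G -> (forall z, 0 <= G z) ->
    \int[Ps s]_z G z =
    \int[P0]_z ((representative_density Xp h1 h2 p s z)%:E * G z).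
  move=> mG G0; apply: ge0_integral_density => //.
  - exact: measurable_representative_density.
  - exact: representative_density_ge0.
  - exact: hPs.
have mdG s G : measurable_fun setT G -> measurable_fun setT
    (fun z => (representative_density Xp h1 h2 p s z)%:E * G z).
  move=> mG; apply: emeasurable_funM => //.
  by apply/measurable_EFinP; exact: measurable_representative_density.
have dG0 s (G : X * Y -> \bar R) : (forall z, 0 <= G z) ->
    forall z, 0 <= (representative_density Xp h1 h2 p s z)%:E * G z.
  by move=> G0 z; rewrite mule_ge0// lee_fin representative_density_ge0.
have off s G : measurable_fun setT G -> (forall z, 0 <= G z) ->
    \int[Ps s]_(z in ~` (fst @^-1` Xp 1)) G z =
    \int[P0]_(z in ~` (fst @^-1` Xp 1)) G z.
  move=> mG G0; rewrite integral_mkcond dens; last 2 first.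
  - apply/(measurable_restrictT _ (measurableC mfB)).
    exact: measurable_funTS.
  - by move=> z; apply: erestrict_ge0.
  rewrite [RHS]integral_mkcond; apply: eq_integral => z _.
  rewrite patchE; case: ifPn => [|_]; last by rewrite mule0.
  by rewrite inE /= => z1; rewrite representative_densityE !memNset ?mul1e// => -[].
move=> s G mG G0; rewrite off// dens// (ge0_integral_setC _ mfB)//; last 2 first.
- exact: mdG.
- exact: dG0.
congr (_ + _); last first.
  apply: eq_integral => z; rewrite inE /= => z1.
  by rewrite representative_densityE !memNset ?mul1e// => -[].
rewrite (integral_conditional_law_in kP0)//; [|exact: mdG|exact: dG0].
apply: eq_integral => x; rewrite inE => Bx.
have x0 := @off_block0 j0 _ Bx.
have [k1 k2] := katoms x x0.
have k2' : k x [set h2 x] = (1 - 2^-1)%:E.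
  by rewrite k2; congr EFin; lra.
have mGx := measurableT_comp (mdG s _ mG) (measurable_pair1 x).
rewrite (integral_two_atoms_off_block0 (prob_kernel x) x0 k1 k2' mGx); last first.
  by move=> y; exact: dG0.
have ne := @atom12 j0 x Bx.
rewrite /= !representative_densityE [(x, atom1 x) \in _]mem_set//.
rewrite [(x, atom2 x) \in _]memNset; last by move=> [_ /= /esym].
rewrite mem_set//= !muleA -!EFinM; congr (_%:E * _ + _%:E * _); lra.
Qed.

End hypercube_two_point.

(** * Excess risk as a sum over blocks *)

Section hypercube_risk.
Context dX dY (X : measurableType dX) (Y : measurableType dY) (R : realType).
Variable l : Y -> Y -> R.
Hypothesis hl : measurable_fun [set: Y * Y] (fun yy => l yy.1 yy.2).
Hypothesis hphi : measurable_fun [set q : R * Y * Y | (0 <= q.1.1 <= 1)%R]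
  (fun q => phi l q.1.2 q.2 q.1.1).
Variables (m : nat) (mu : probability X R) (Xp : nat -> set X)
  (h1 h2 : X -> Y) (p : bool -> X -> R).
Variable P_ : {ffun 'I_m -> bool} -> probability (X * Y)%type R.
Hypothesis hcube : hypercube mu Xp h1 h2 p P_.
Variable y0 : Y.

Let a1 := atom1 Xp h1 y0.
Let a2 := atom2 Xp h2 y0.
Let w := weight Xp p.

Variable s : {ffun 'I_m -> bool}.
Hypothesis hPs : risk_well_defined l (P_ s).
Hypothesis hmin : conditional_minimum mu Xp h1 h2 p l s.

Lemma hypercube_integral (G : X * Y -> \bar R) :
  measurable_fun setT G -> (forall z, 0 <= G z) ->
  \int[P_ s]_z G z = \int[P_ s]_(z in fst @^-1` Xp 0) G z +
    \sum_(j < m) block_integral mu (Xp j.+1) a1 a2 w (s j) G.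
Proof.
move=> mG G0; have [k [kP katoms _]] := hypercube_law hcube.
have mF (i : 'I_m.+1) : measurable (fst @^-1` Xp i : set (X * Y)).
  rewrite -[X in measurable X]setTI; apply: measurable_fst => //.
  by apply: (measurable_block hcube); rewrite -ltnS.
have cover : \big[setU/set0]_(i < m.+1) (fst @^-1` Xp i : set (X * Y)) = setT.
  rewrite -bigcup_mkord_ord; apply/seteqP; split => // z _.
  have [i /= im zi] : (\bigcup_(i in [set i | (i <= m)%N]) Xp i) z.1.
    by rewrite (hypercube_cover hcube).
  by exists i => //=; rewrite inordK.
rewrite -[in LHS]cover (@ge0_integral_bigsetU _ _ _ _ _
  (fun i : 'I_m.+1 => fst @^-1` Xp i : set (X * Y)))//; last 3 first.
- exact: index_enum_uniq.
- apply/trivIsetP => i i' _ _ ii'; apply/seteqP; split => // z [zi zi'].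
  move/eqP: ii'; apply; apply: val_inj.
  by apply: (block_disjoint hcube) zi zi'; rewrite -ltnS.
- exact: measurable_funTS.
rewrite big_ord_recl; congr (_ + _); apply: eq_bigr => j _.
have mB := measurable_block hcube (ltn_ord j).
rewrite lift0 (integral_conditional_law_in (kP s) mB mG G0).
apply: eq_integral => x; rewrite inE => Bx; have x0 := off_block0 hcube Bx.
have [k1 k2] := katoms s j x Bx.
have mGx : measurable_fun setT (fun y => G (x, y)).
  exact: (measurableT_comp mG (measurable_pair1 x)).
rewrite (integral_two_atoms_off_block0 hcube y0 (prob_kernel x) x0 k1 k2 mGx)//.
by rewrite /w weightE.
Qed.

Let loss_pos (g : X -> Y) (z : X * Y) : \bar R :=
  (Num.max (l z.2 (g z.1)) 0%R)%:E.
Let loss_neg (g : X -> Y) (z : X * Y) : \bar R :=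
  (Num.max (- l z.2 (g z.1)) 0)%R%:E.

Let loss_pos_ge0 g z : 0 <= loss_pos g z.
Proof. by rewrite lee_fin le_max lexx orbT. Qed.

Let loss_neg_ge0 g z : 0 <= loss_neg g z.
Proof. by rewrite lee_fin le_max lexx orbT. Qed.

Let measurable_loss_comp d (T : measurableType d) (f h : T -> Y) :
  measurable_fun setT f -> measurable_fun setT h ->
  measurable_fun setT (fun t => l (f t) (h t)).
Proof.
by move=> mf mh; exact: (measurableT_comp hl (measurable_fun_pair mf mh)).
Qed.

Let measurable_loss_pos g : measurable_fun setT g ->
  measurable_fun setT (loss_pos g).
Proof.
move=> mg; apply/measurable_EFinP; apply: measurable_maxr => //.
apply: measurable_loss_comp => //.
exact: (measurableT_comp mg).
Qed.

Let measurable_loss_neg g : measurable_fun setT g ->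
  measurable_fun setT (loss_neg g).
Proof.
move=> mg; apply/measurable_EFinP; apply: measurable_maxr => //.
apply: measurable_funN; apply: measurable_loss_comp => //.
exact: (measurableT_comp mg).
Qed.

Let riskE P g : risk l P g = \int[P]_z loss_pos g z - \int[P]_z loss_neg g z.
Proof.
rewrite /risk integralE; congr (_ - _); apply: eq_integral => z _.
  by rewrite funeposE /loss_pos EFin_max.
by rewrite funenegE /loss_neg EFin_max.
Qed.

Let int_loss_neg g : measurable_fun setT g ->
  \int[P_ s]_z loss_neg g z \is a fin_num.
Proof.
move=> mg; rewrite ge0_fin_numE; first exact: hPs.1.
by apply: integral_ge0 => z _; exact: loss_neg_ge0.
Qed.

Lemma min_risk_fin_num : min_risk l (P_ s) \is a fin_num.
Proof.
have [_ [g [mg gfin gmin]]] := hPs.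
have -> : min_risk l (P_ s) = risk l (P_ s) g.
  apply/eqP; rewrite eq_le; apply/andP; split.
    by apply: ereal_inf_lbound; exists g.
  by apply: le_ereal_inf_tmp => _ [g' mg' <-]; exact: gmin.
rewrite fin_numElt gfin andbT riskE.
rewrite (@lt_le_trans _ _ (- (\int[P_ s]_z loss_neg g z)))//.
  have : (- (\int[P_ s]_z loss_neg g z)) \is a fin_num by rewrite fin_numN int_loss_neg.
  by rewrite fin_numElt => /andP[].
rewrite -[leLHS]add0e leeD2r//.
by apply: integral_ge0 => z _; exact: loss_pos_ge0.
Qed.

Let excess_sum g :=
  \sum_(j < m) \int[mu]_(x in Xp j.+1) (excess l a1 a2 w (s j) x (g x))%:E.

(** The competitor [g'] follows the conditional minimiser on the blocks and [g] itself on [Xp 0],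
    where nothing is known of the conditional law. The two contributions of [Xp 0] then cancel
    exactly, and on each block the conditional risks of [g] and [g'] differ by the excess. *)
Lemma min_risk_excess g : measurable_fun setT g ->
  min_risk l (P_ s) + excess_sum g <= risk l (P_ s) g.
Proof.
move=> mg; have [gs mgs gs_min] := hmin.
pose g' x := if x \in Xp 0 then g x else gs x.
have mX0 : measurable (Xp 0) := measurable_block hcube (leq0n m).
have mg' : measurable_fun setT g'.
  by apply: measurable_fun_ifT => //; exact: measurable_fun_mem.
have min_le : min_risk l (P_ s) <= risk l (P_ s) g'.
  by apply: ereal_inf_lbound; exists g'.
have mw b : measurable_fun setT (w b) := measurable_weight hcube b.
have w01 : forall b x, (0 <= w b x <= 1)%R := weight01 hcube.
have ma1 : measurable_fun setT a1 := measurable_atom1 hcube y0.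
have ma2 : measurable_fun setT a2 := measurable_atom2 hcube y0.
have mblock (G : X * Y -> \bar R) b : measurable_fun setT G ->
    measurable_fun setT (fun x => (w b x)%:E * G (x, a1 x) +
      (1 - w b x)%:E * G (x, a2 x)).
  move=> mG; apply: emeasurable_funD; apply: emeasurable_funM.
  - exact/measurable_EFinP.
  - by apply: (measurableT_comp mG); exact: measurable_fun_pair.
  - by apply/measurable_EFinP; exact: measurable_funB.
  - by apply: (measurableT_comp mG); exact: measurable_fun_pair.
have block0 (G : X * Y -> \bar R) b x : (forall z, 0 <= G z) ->
    0 <= (w b x)%:E * G (x, a1 x) + (1 - w b x)%:E * G (x, a2 x).
  move=> G0; have /andP[? ?] := w01 b x.
  by rewrite adde_ge0// mule_ge0// lee_fin// subr_ge0.
(* Infinite integrals of the loss are never subtracted: the comparison of the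
   risks of g and g' is made between sums of nonnegative parts. *)
pose G1 z := loss_pos g' z + loss_neg g z.
pose G2 z := loss_pos g z + loss_neg g' z.
have mG1 : measurable_fun setT G1.
  by apply: emeasurable_funD; [exact: measurable_loss_pos|exact: measurable_loss_neg].
have mG2 : measurable_fun setT G2.
  by apply: emeasurable_funD; [exact: measurable_loss_pos|exact: measurable_loss_neg].
have G10 z : 0 <= G1 z by rewrite adde_ge0.
have G20 z : 0 <= G2 z by rewrite adde_ge0.
have le12 : \int[P_ s]_z G1 z + excess_sum g <= \int[P_ s]_z G2 z.
  rewrite !hypercube_integral// -addeA; apply: leeD.
    rewrite le_eqVlt; apply/orP; left; apply/eqP.
    apply: eq_integral => z; rewrite inE /= => z0.
    by rewrite /G1 /G2 /loss_pos /loss_neg /g' mem_set.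
  rewrite /excess_sum -big_split/=; apply: lee_sum => j _.
  have mB := measurable_block hcube (ltn_ord j).
  have me : measurable_fun (Xp j.+1)
      (fun x => (excess l a1 a2 w (s j) x (g x))%:E).
    apply: measurable_funTS; apply/measurable_EFinP.
    exact: (measurable_excess hl hphi ma1 ma2 mw w01).
  have e0 x : 0 <= (excess l a1 a2 w (s j) x (g x))%:E.
    by rewrite lee_fin excess_ge0.
  rewrite /block_integral -ge0_integralD//; last 2 first.
  - by move=> x _; exact: block0.
  - by apply: measurable_funTS; exact: mblock.
  apply: ae_ge0_le_integral => //.
  - by move=> x _; rewrite adde_ge0// block0.
  - by apply: emeasurable_funD => //; apply: measurable_funTS; exact: mblock.
  - by move=> x _; exact: block0.
  - by apply: measurable_funTS; exact: mblock.
  apply: filterS gs_min => x gsx Bx.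
  have x0 := off_block0 hcube Bx.
  have {}gsx y := gsx j y Bx.
  have phiE := phi_attained gsx.
  have exE : excess l a1 a2 w (s j) x (g x) =
      (varphi l (p (s j) x) (h1 x) (h2 x) (g x) -
       varphi l (p (s j) x) (h1 x) (h2 x) (gs x))%R.
    rewrite /excess /a1 /a2 /w atom1E// atom2E// weightE// phiE max_l//.
    by rewrite subr_ge0.
  rewrite exE /G1 /G2 /loss_pos /loss_neg /g' memNset//=.
  rewrite /a1 /a2 /w atom1E// atom2E// weightE//.
  rewrite -!EFinD lee_fin /varphi.
  (* With each loss written as the difference of its parts, and the parts generalised to free
     variables, the inequality becomes a polynomial identity. *)
  have maxE (t : R) : (t = Num.max t 0 - Num.max (- t) 0)%R.
    case: (leP 0%R t) => t0; first by rewrite max_r ?oppr_le0// subr0.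
    by rewrite max_l ?oppr_ge0 ?ltW// sub0r opprK.
  move: (maxE (l (h1 x) (g x))) (maxE (l (h2 x) (g x)))
    (maxE (l (h1 x) (gs x))) (maxE (l (h2 x) (gs x))).
  set A1 := Num.max (l (h1 x) (g x)) _; set B1 := Num.max (- l (h1 x) (g x))%R _.
  set A2 := Num.max (l (h2 x) (g x)) _; set B2 := Num.max (- l (h2 x) (g x))%R _.
  set C1 := Num.max (l (h1 x) (gs x)) _; set D1 := Num.max (- l (h1 x) (gs x))%R _.
  set C2 := Num.max (l (h2 x) (gs x)) _; set D2 := Num.max (- l (h2 x) (gs x))%R _.
  move: A1 B1 A2 B2 C1 D1 C2 D2 => A1 B1 A2 B2 C1 D1 C2 D2 -> -> -> ->.
  rewrite le_eqVlt; apply/orP; left; apply/eqP; ring.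
apply: (@le_trans _ _ (risk l (P_ s) g' + excess_sum g)).
  exact: leeD2r.
rewrite !riskE.
move: le12.
rewrite !ge0_integralD//; [|exact: measurable_loss_pos|exact: measurable_loss_neg
  |exact: measurable_loss_pos|exact: measurable_loss_neg].
have fb := int_loss_neg mg'; have fd := int_loss_neg mg.
move: fb fd.
set a := \int[P_ s]_z loss_pos g' z; set b := \int[P_ s]_z loss_neg g' z.
set c := \int[P_ s]_z loss_pos g z; set e := \int[P_ s]_z loss_neg g z.
move=> fb fd H.
(* Only the negative parts [b] and [e] are known to be finite, and they are the only terms moved
   across; [a] and [c] may be infinite. *)
rewrite leeBrDr//.
have -> : a - b + excess_sum g + e = a + e + excess_sum g - b.
  by rewrite addeAC (addeAC a (- b)) addeAC.
by rewrite leeBlDr.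
Qed.

Lemma expected_risk_ge n (ghat : n.-tuple (X * Y)%type -> X -> Y) :
  measurable_estimator ghat ->
  \sum_(j < m) \int[power_probability (P_ s) n]_v
    block_risk l mu a1 a2 w ghat (Xp j.+1) (s j) v <=
  expected_risk l (P_ s) ghat - min_risk l (P_ s).
Proof.
move=> mghat; have fin := min_risk_fin_num.
have mw b : measurable_fun setT (w b) := measurable_weight hcube b.
have w01 : forall b x, (0 <= w b x <= 1)%R := weight01 hcube.
have ma1 : measurable_fun setT a1 := measurable_atom1 hcube y0.
have ma2 : measurable_fun setT a2 := measurable_atom2 hcube y0.
have mrisk (j : 'I_m) : measurable_fun setT
    (block_risk l mu a1 a2 w ghat (Xp j.+1) (s j)).
  apply: (measurable_block_risk hl hphi mu ma1 ma2 mw w01 mghat).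
  exact: (measurable_block hcube (ltn_ord j)).
rewrite leeBrDr// addeC -ge0_integral_sum//; last first.
  by move=> j v _; exact: block_risk_ge0.
rewrite -[X in X + _](fineK fin) /expected_risk.
have mgz : measurable_fun setT
    (fun vz : n.-tuple (X * Y) * (X * Y) => ghat vz.1 vz.2.1).
  apply: (measurableT_comp mghat (g := fun vz : n.-tuple (X * Y) * (X * Y) =>
    (vz.1, vz.2.1))).
  apply: measurable_fun_pair => //.
  exact: (measurableT_comp measurable_fst measurable_snd).
have mz2 : measurable_fun setT (fun vz : n.-tuple (X * Y) * (X * Y) => vz.2.2).
  exact: (measurableT_comp measurable_snd measurable_snd).
apply: lee_integralDcst.
- under eq_fun do rewrite riskE.
  apply: emeasurable_funB.
    apply: (@measurable_fun_integral_param _ _ _ _ _ _ _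
      (fun v z => loss_pos (ghat v) z)) => //.
    apply/measurable_EFinP; apply: measurable_maxr => //.
    exact: measurable_loss_comp.
  apply: (@measurable_fun_integral_param _ _ _ _ _ _ _
    (fun v z => loss_neg (ghat v) z)) => //.
  apply/measurable_EFinP; apply: measurable_maxr => //.
  by apply: measurable_funN; exact: measurable_loss_comp.
- by apply: emeasurable_sum => j; exact: mrisk.
- by move=> v; apply: sume_ge0 => j _; exact: block_risk_ge0.
move=> v; rewrite fineK//; apply: min_risk_excess.
exact: (measurableT_comp mghat (measurable_pair1 v)).
Qed.

End hypercube_risk.

(** * Averaging over the signs *)

(** Flipping the j-th sign is an involution of the sign vectors, so [a j s] and its value at the
    flipped vector have the same sum over all [s]. Each pair contributes at least [t], hence the
    factor 2 on the right, which becomes the 1/2 of the characteristic function. *)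
Lemma flip_averaging (R : realType) m
    (a : 'I_m -> {ffun 'I_m -> bool} -> R) (t e : R) :
  (forall s, \sum_(j < m) a j s <= e)%R ->
  (forall s j, t <= a j (upd s j false) + a j (upd s j true))%R ->
  (m%:R * t <= 2 * e)%R.
Proof.
move=> ae ta; pose S := {ffun 'I_m -> bool}.
pose flip (j : 'I_m) (s : S) := upd s j (~~ s j).
have flipK j : involutive (flip j).
  move=> s; apply/ffunP => i; rewrite !ffunE; case: eqP => // ->.
  by rewrite eqxx negbK.
have tflip j s : (t <= a j s + a j (flip j s))%R.
  have updE b : s j = b -> upd s j b = s.
    by move=> sj; apply/ffunP => i; rewrite ffunE; case: eqP => // ->.
  rewrite /flip; case sj: (s j); rewrite /= -[in a j s](updE _ sj); last exact: ta.
  by rewrite addrC; exact: ta.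
have N0 : (0 < #|S|%:R :> R)%R.
  by rewrite ltr0n; apply/card_gt0P; exists [ffun=> true].
rewrite -(ler_pM2l N0).
have -> : (#|S|%:R * (m%:R * t) = \sum_(s : S) \sum_(j < m) t)%R.
  by rewrite !sumr_const card_ord !mulr_natl.
apply: (@le_trans _ _ (\sum_(s : S) \sum_(j < m) (a j s + a j (flip j s)))%R).
  by apply: ler_sum => s _; apply: ler_sum => j _; exact: tflip.
rewrite exchange_big/=.
under eq_bigr do rewrite big_split/=.
have -> : (\sum_(j < m) (\sum_(s : S) a j s + \sum_(s : S) a j (flip j s)) =
    2 * \sum_(s : S) \sum_(j < m) a j s)%R.
  rewrite [in RHS]exchange_big/= mulr_sumr; apply: eq_bigr => j _.
  have <- : (\sum_(s : S) a j s = \sum_(s : S) a j (flip j s))%R.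
    by rewrite (reindex_inj (inv_inj (flipK j))).
  by rewrite -mulr2n mulr_natl.
rewrite mulrCA ler_wpM2l//.
have -> : (#|S|%:R * e = \sum_(s : S) e)%R by rewrite sumr_const mulr_natl.
by apply: ler_sum.
Qed.

(* Truncation to [0, 1], which makes the functions of a quadruple
   (p_+, p_-, h_1, h_2) used below measurable on the whole product space. *)
Definition clamp (R : realType) (t : R) : R := Num.max 0%R (Num.min t 1%R).

Lemma clamp01 (R : realType) (t : R) : (0 <= clamp t <= 1)%R.
Proof. by rewrite le_max lexx/= ge_max ler01 ge_min lexx orbT. Qed.

Lemma clamp_id (R : realType) (t : R) : (0 <= t <= 1)%R -> clamp t = t.
Proof. by move=> /andP[t0 t1]; rewrite /clamp min_l// max_r. Qed.

Lemma measurable_fun_clamp d (T : measurableType d) (R : realType) (f : T -> R) :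
  measurable_fun setT f -> measurable_fun setT (fun t => clamp (f t)).
Proof. by move=> mf; apply: measurable_maxr => //; exact: measurable_minr. Qed.

(** * Independence of the block *)

Section hypercube_law.
Context dX dY (X : measurableType dX) (Y : measurableType dY) (R : realType).
Variable l : Y -> Y -> R.
Hypothesis hphi : measurable_fun [set q : R * Y * Y | (0 <= q.1.1 <= 1)%R]
  (fun q => phi l q.1.2 q.2 q.1.1).
Variables (m : nat) (mu : probability X R) (Xp : nat -> set X)
  (h1 h2 : X -> Y) (p : bool -> X -> R).
Variable P_ : {ffun 'I_m -> bool} -> probability (X * Y)%type R.
Hypothesis hcube : hypercube mu Xp h1 h2 p P_.
Variable y0 : Y.

Let a1 := atom1 Xp h1 y0.
Let a2 := atom2 Xp h2 y0.
Let w := weight Xp p.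

Let mw b : measurable_fun setT (w b). Proof. exact: (measurable_weight hcube). Qed.
Let w01 b x : (0 <= w b x <= 1)%R. Proof. exact: (weight01 hcube). Qed.
Let ma1 : measurable_fun setT a1. Proof. exact: (measurable_atom1 hcube). Qed.
Let ma2 : measurable_fun setT a2. Proof. exact: (measurable_atom2 hcube). Qed.

Lemma hypercube_law_integral (j j' : 'I_m) (F : R * R * Y * Y -> \bar R) :
  measurable_fun setT F -> (forall v, 0 <= F v) ->
  \int[mu]_(x in Xp j.+1) F (w true x, w false x, a1 x, a2 x) =
  \int[mu]_(x in Xp j'.+1) F (w true x, w false x, a1 x, a2 x).
Proof.
move=> mF F0; pose V x := (w true x, w false x, a1 x, a2 x).
have mV : measurable_fun setT V.
  by do 3?apply: measurable_fun_pair.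
have mB (i : 'I_m) := measurable_block hcube (ltn_ord i).
apply: (eq_law_integral mV (mB j) (mB j') _ mF F0) => U mU.
have VE (i : 'I_m) : Xp i.+1 `&` V @^-1` U =
    Xp i.+1 `&` (fun x => (p true x, p false x, h1 x, h2 x)) @^-1` U.
  apply/seteqP; split => x /= [Bx]; have x0 := off_block0 hcube Bx;
  by rewrite /V /w /a1 /a2 !weightE// atom1E// atom2E.
have mVU (i : 'I_m) : measurable (Xp i.+1 `&` V @^-1` U).
  by apply: measurableI => //; rewrite -[X in measurable X]setTI; exact: mV.
have := hypercube_eq_law hcube j j' mU; rewrite /law_given.
rewrite (hypercube_eq_mass hcube j' j) -!VE.
(* When the blocks have mass 0, [law_given] is identically 0, because the inverse of 0 is 0, and
   carries no information; but then all blocks are null. Otherwise the normalisation cancels, being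
   the same for both blocks. *)
have [B0|B0] := eqVneq (fine (mu (Xp j.+1))) 0%R.
  have Z (i : 'I_m) : mu (Xp i.+1 `&` V @^-1` U) = 0.
    apply/eqP; rewrite -measure_le0.
    rewrite (@le_trans _ _ (mu (Xp i.+1)))//.
      by apply: le_measure; rewrite ?inE//; exact: subIsetl.
    rewrite (hypercube_eq_mass hcube i j) -[X in X <= _](@fineK _ (mu (Xp j.+1))).
      by rewrite B0.
    exact: fin_num_measure.
  by move=> _; rewrite [LHS]Z [RHS]Z.
move=> /(congr1 (fun t => t * (fine (mu (Xp j.+1)))%:E)).
by rewrite -!muleA -!EFinM mulVf// !mule1.
Qed.

Lemma block_function_hypercube (j j' : 'I_m) u :
  block_function l mu a1 a2 w (Xp j.+1) u =
  block_function l mu a1 a2 w (Xp j'.+1) u.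
Proof.
rewrite /block_function; congr (_ * _).
pose F (v : R * R * Y * Y) : \bar R := (Num.max (psi l (clamp v.1.1.1)
  (clamp v.1.1.2) v.1.2 v.2 (`|u| / (`|u| + 1))%R) 0%R)%:E.
have FE x : F (w true x, w false x, a1 x, a2 x) = (psi_pos l a1 a2 w u x)%:E.
  by rewrite /F /= !clamp_id.
under eq_integral do rewrite -FE.
under [RHS]eq_integral do rewrite -FE.
apply: hypercube_law_integral => [|v]; last by rewrite lee_fin le_max lexx orbT.
have m111 := measurableT_comp (@measurable_fst _ _ R R)
  (measurableT_comp (@measurable_fst _ _ (R * R)%type Y)
    (@measurable_fst _ _ (R * R * Y)%type Y)).
have m112 := measurableT_comp (@measurable_snd _ _ R R)
  (measurableT_comp (@measurable_fst _ _ (R * R)%type Y)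
    (@measurable_fst _ _ (R * R * Y)%type Y)).
apply/measurable_EFinP; apply: measurable_maxr => //.
apply: (measurable_fun_psi hphi).
- exact: (measurable_fun_clamp m111).
- exact: (measurable_fun_clamp m112).
- exact: (measurableT_comp measurable_snd measurable_fst).
- exact: measurable_snd.
- exact: measurable_cst.
- by move=> v; exact: clamp01.
- by move=> v; exact: clamp01.
- by move=> v; exact: norm_ratio01.
Qed.

(** Since [P] and [P'] are arbitrary two-point families, the representatives on the first block can
    be compared with any hypercube pair on its own block. *)
Lemma ratio_hypercube (j j' : 'I_m) (P P' : bool -> probability (X * Y)%type R) :
  two_point mu (Xp j.+1) a1 a2 w P -> two_point mu (Xp j'.+1) a1 a2 w P' ->
  forall H : R -> \bar R, measurable_fun setT H -> (forall t, 0 <= H t) ->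
  \int[P false]_z H (ratio (Xp j.+1) a1 a2 w z) =
  \int[P' false]_z H (ratio (Xp j'.+1) a1 a2 w z).
Proof.
move=> PB PB' H mH H0.
have law (i : 'I_m) P1 (P1B : two_point mu (Xp i.+1) a1 a2 w P1) :=
  two_point_law (measurable_block hcube (ltn_ord i)) mw w01
    (measurable_graph1 hcube y0 i) (measurable_graph2 hcube y0 i)
    (@atom12 _ _ _ _ _ _ _ _ _ _ _ _ hcube y0 i) P1B mH H0.
rewrite (law _ _ PB) (law _ _ PB') (hypercube_eq_mass hcube j' j).
congr (_ + _).
pose F (v : R * R * Y * Y) : \bar R :=
  (clamp v.1.1.2)%:E * H (clamp v.1.1.1 / clamp v.1.1.2)%R +
  (1 - clamp v.1.1.2)%:E * H ((1 - clamp v.1.1.1) / (1 - clamp v.1.1.2))%R.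
have FE x : F (w true x, w false x, a1 x, a2 x) =
    (w false x)%:E * H (w true x / w false x)%R +
    (1 - w false x)%:E * H ((1 - w true x) / (1 - w false x))%R.
  by rewrite /F /= !clamp_id.
under eq_integral do rewrite -FE.
under [RHS]eq_integral do rewrite -FE.
have c0 (t : R) : (0 <= clamp t)%R by case/andP: (clamp01 t).
have c1 (t : R) : (0 <= 1 - clamp t)%R by rewrite subr_ge0; case/andP: (clamp01 t).
apply: hypercube_law_integral => [|v]; last first.
  by rewrite adde_ge0// mule_ge0// lee_fin.
have m111 := measurable_fun_clamp (measurableT_comp (@measurable_fst _ _ R R)
  (measurableT_comp (@measurable_fst _ _ (R * R)%type Y)
    (@measurable_fst _ _ (R * R * Y)%type Y))).
have m112 := measurable_fun_clamp (measurableT_comp (@measurable_snd _ _ R R)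
  (measurableT_comp (@measurable_fst _ _ (R * R)%type Y)
    (@measurable_fst _ _ (R * R * Y)%type Y))).
have m1 := measurable_funB (measurable_cst (1%R : R)) m111.
have m2 := measurable_funB (measurable_cst (1%R : R)) m112.
apply: emeasurable_funD; apply: emeasurable_funM.
- exact/measurable_EFinP.
- by apply: (measurableT_comp mH); exact: measurable_fun_div.
- exact/measurable_EFinP.
- by apply: (measurableT_comp mH); exact: measurable_fun_div.
Qed.

End hypercube_law.

(** * Similarity of the representatives and block risks *)

Section hypercube_similarity.
Context dX dY (X : measurableType dX) (Y : measurableType dY) (R : realType).
Variable l : Y -> Y -> R.
Hypothesis hl : measurable_fun [set: Y * Y] (fun yy => l yy.1 yy.2).
Hypothesis hphi : measurable_fun [set q : R * Y * Y | (0 <= q.1.1 <= 1)%R]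
  (fun q => phi l q.1.2 q.2 q.1.1).
Variables (m : nat) (mu : probability X R) (Xp : nat -> set X)
  (h1 h2 : X -> Y) (p : bool -> X -> R).
Variable P_ : {ffun 'I_m -> bool} -> probability (X * Y)%type R.
Hypothesis hm : (1 <= m)%N.
Hypothesis hcube : hypercube mu Xp h1 h2 p P_.
Hypothesis hmin : forall s : {ffun 'I_m -> bool},
  conditional_minimum mu Xp h1 h2 p l s.
Variable y0 : Y.
Variables (P0 : probability (X * Y)%type R)
  (Ps : bool -> probability (X * Y)%type R).
Hypothesis hP0 : representative_base mu Xp h1 h2 P0.
Hypothesis hPs : forall s, representative Xp h1 h2 p P0 s (Ps s).

Let a1 := atom1 Xp h1 y0.
Let a2 := atom2 Xp h2 y0.
Let w := weight Xp p.
Let j0 : 'I_m := Ordinal hm.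

Let mw b : measurable_fun setT (w b). Proof. exact: (measurable_weight hcube). Qed.
Let w01 b x : (0 <= w b x <= 1)%R. Proof. exact: (weight01 hcube). Qed.
Let ma1 : measurable_fun setT a1. Proof. exact: (measurable_atom1 hcube). Qed.
Let ma2 : measurable_fun setT a2. Proof. exact: (measurable_atom2 hcube). Qed.
Let mB (j : 'I_m) : measurable (Xp j.+1).
Proof. exact: (measurable_block hcube (ltn_ord j)). Qed.
Let mG1 (j : 'I_m) := measurable_graph1 hcube y0 j.
Let mG2 (j : 'I_m) := measurable_graph2 hcube y0 j.
Let a12 (j : 'I_m) := @atom12 _ _ _ _ _ _ _ _ _ _ _ _ hcube y0 j.
Let PsB : two_point mu (Xp 1) a1 a2 w Ps.
Proof. exact: (representative_two_point hcube y0 hm hP0 hPs). Qed.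

Let r (j : 'I_m) := ratio (Xp j.+1) a1 a2 w.
Let e (j : 'I_m) := ratio_dom (Xp j.+1) a1 a2 w.

Lemma block_attained (j : 'I_m) : {ae mu, forall x, Xp j.+1 x ->
  forall b, attained l (w b x) (a1 x) (a2 x)}.
Proof.
(* The two constant sign vectors provide minimisers for p_+ and for p_- on all blocks at once. *)
have [gp _ Hp] := hmin [ffun=> true]; have [gm _ Hm] := hmin [ffun=> false].
apply: filterS2 Hp Hm => x Hp Hm Bx b; have x0 := off_block0 hcube Bx.
rewrite /w /a1 /a2 weightE// atom1E// atom2E//; case: b.
  by exists (gp x) => y; have := Hp j y Bx; rewrite ffunE.
by exists (gm x) => y; have := Hm j y Bx; rewrite ffunE.
Qed.

Lemma characteristic_functionE (u : R) : (0 <= u)%R ->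
  characteristic_function m mu Xp h1 h2 p l u =
  (2^-1 * m%:R)%:E * block_function l mu a1 a2 w (Xp 1) u.
Proof.
move=> u0; rewrite /characteristic_function /block_function muleA -EFinM.
rewrite ger0_norm//; congr (_ * _).
have mpsi : measurable_fun (Xp 1)
    (fun x => (psi l (w true x) (w false x) (a1 x) (a2 x) (u / (u + 1)))%:E).
  apply: measurable_funTS; apply/measurable_EFinP.
  apply: (measurable_fun_psi hphi) => // _.
  by have := norm_ratio01 u; rewrite ger0_norm.
transitivity (\int[mu]_(x in Xp 1)
    (psi l (w true x) (w false x) (a1 x) (a2 x) (u / (u + 1)))%:E).
  apply: eq_integral => x; rewrite inE => Bx.
  have x0 := @off_block0 _ _ _ _ _ _ _ _ _ _ _ _ hcube j0 x Bx.
  by rewrite /w /a1 /a2 !weightE// atom1E// atom2E.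
apply: ae_eq_integral => //.
- exact: mB j0.
- apply: measurable_funTS; apply/measurable_EFinP.
  exact: (measurableT_comp (measurable_psi_pos hphi ma1 ma2 mw w01)
    (measurable_pair1 u)).
apply: filterS (block_attained j0) => x pE Bx; have {}pE := pE Bx.
rewrite /psi_pos ger0_norm// max_l//.
have := norm_ratio01 u; rewrite ger0_norm// => u01.
by case/andP: (psi_bounds (a1 x) (pE true) (pE false) u01).
Qed.

Lemma f_similarity_block_function n :
  f_similarity (power_probability (Ps true) n) (power_probability (Ps false) n)
    (characteristic_function m mu Xp h1 h2 p l) =
  (2^-1 * m%:R)%:E * \int[power_probability (Ps false) n]_v
    block_function l mu a1 a2 w (Xp 1) (tuple_prod (r j0) v).
Proof.
have c0 : (0 <= 2^-1 * m%:R :> R)%R by rewrite mulr_ge0.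
have mbf := measurable_block_function hphi mu ma1 ma2 mw w01 (mB j0).
have mr := measurable_ratio mw w01 (mG1 j0) (mG2 j0).
have me := measurable_ratio_dom mw (mG1 j0) (mG2 j0).
have r0 z : (0 <= r j0 z)%R := ratio_ge0 (Xp 1) a1 a2 w01 z.
have e01 z : (0 <= e j0 z <= 1)%R := ratio_dom01 (Xp 1) a1 a2 w z.
have e0 z : (0 <= e j0 z)%R by case/andP: (e01 z).
have tr0 v : (0 <= tuple_prod (r j0) (n := n) v)%R by exact: tuple_prod_ge0.
have PQ := integral_power_density me mr e0 r0
  (two_point_density mw w01 (mG1 j0) (mG2 j0) (@a12 j0) PsB) (n := n).
have QQ (G : n.-tuple (X * Y) -> \bar R) :
    measurable_fun setT G -> (forall v, 0 <= G v) ->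
    \int[power_probability (Ps false) n]_v ((tuple_prod (e j0) v)%:E * G v) =
    \int[power_probability (Ps false) n]_v G v.
  move=> mG G0.
  have m1 : measurable_fun setT (fun _ : X * Y => 1%R : R) by [].
  (* Written with the density 1 on the right, the one-sample identity tensorises by the same lemma
     as the ratio. *)
  have D (G' : X * Y -> \bar R) : measurable_fun setT G' -> (forall z, 0 <= G' z) ->
      \int[Ps false]_z ((e j0 z)%:E * G' z) = \int[Ps false]_z (1%:E * G' z).
    move=> mG' G'0; under [RHS]eq_integral do rewrite mul1e.
    exact: (two_point_dom mw (mG1 j0) (mG2 j0) (@a12 j0) PsB).
  rewrite (integral_power_density me m1 e0 (fun=> ler01) D mG G0).
  by apply: eq_integral => v _; rewrite tuple_prod1 mul1e.
rewrite (f_similarity_ratio (measurable_tuple_prod me)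
  (measurable_tuple_prod mr) _ tr0 PQ QQ).
- under eq_integral do rewrite characteristic_functionE//.
  rewrite ge0_integralZl//.
  + exact: (measurableT_comp mbf (measurable_tuple_prod mr)).
  + by move=> v _; exact: block_function_ge0.
- move=> v; rewrite tuple_prod_ge0//=; exact: tuple_prod_le1.
- apply: (eq_measurable_fun (fun u => (2^-1 * m%:R)%:E *
    block_function l mu a1 a2 w (Xp 1) u)).
    by move=> u; rewrite inE /= => u0; rewrite characteristic_functionE.
  apply: measurable_funTS; exact: measurable_funeM.
- move=> u u0; rewrite characteristic_functionE// mule_ge0//.
  exact: block_function_ge0.
Qed.

(** The left-hand side depends neither on [s] nor on [j], as the averaging requires: the block
    function is the same for all blocks, and the law of the n-sample ratio is determined by that of
    the one-sample ratio, which the representatives share. *)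
Lemma representative_le_block_risk s j n
    (g : n.-tuple (X * Y)%type -> X -> Y) : measurable_estimator g ->
  \int[power_probability (Ps false) n]_v
    block_function l mu a1 a2 w (Xp 1) (tuple_prod (r j0) v) <=
  \int[power_probability (P_ (upd s j false)) n]_v
    block_risk l mu a1 a2 w g (Xp j.+1) false v +
  \int[power_probability (P_ (upd s j true)) n]_v
    block_risk l mu a1 a2 w g (Xp j.+1) true v.
Proof.
move=> mg; have PB := hypercube_two_point hcube y0 s j.
apply: le_trans (two_point_bound hl hphi ma1 ma2 mw w01 (mB j) (mG1 j) (mG2 j)
  (@a12 j) (block_attained j) PB mg).
rewrite le_eqVlt; apply/orP; left; apply/eqP.
under [RHS]eq_integral do rewrite (block_function_hypercube hphi hcube y0 j j0).
apply: integral_power_law.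
- exact: (measurable_ratio mw w01 (mG1 j0) (mG2 j0)).
- exact: (measurable_ratio mw w01 (mG1 j) (mG2 j)).
- exact: (ratio_hypercube hcube (j := j0) (j' := j) PsB PB).
- exact: (measurable_block_function hphi mu ma1 ma2 mw w01 (mB j0)).
- by move=> t; exact: block_function_ge0.
Qed.

End hypercube_similarity.

Theorem theorem8p6 (R : realType) (dX dY : measure_display)
  (X : measurableType dX) (Y : measurableType dY)
  (l : Y -> Y -> R)
  (hl : measurable_fun [set: Y * Y] (fun yy => l yy.1 yy.2))
  (hphi : measurable_fun [set q : R * Y * Y | (0 <= q.1.1 <= 1)%R]
            (fun q => phi l q.1.2 q.2 q.1.1))
  (PP : set (probability (X * Y)%type R))
  (hPP : forall P, PP P -> risk_well_defined l P)
  (m : nat) (hm : (1 <= m)%N)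
  (mu : probability X R) (Xp : nat -> set X)
  (h1 h2 : X -> Y) (p : bool -> X -> R)
  (P_ : {ffun 'I_m -> bool} -> probability (X * Y)%type R)
  (hcube : hypercube mu Xp h1 h2 p P_)
  (hmin : forall s : {ffun 'I_m -> bool},
     conditional_minimum mu Xp h1 h2 p l s)
  (hP_ : forall s, PP (P_ s))
  (P0 Pplus Pminus : probability (X * Y)%type R)
  (hP0 : representative_base mu Xp h1 h2 P0)
  (hPplus : representative Xp h1 h2 p P0 true Pplus)
  (hPminus : representative Xp h1 h2 p P0 false Pminus)
  (n : nat) (hn : (1 <= n)%N)
  (ghat : n.-tuple (X * Y)%type -> X -> Y)
  (hghat : measurable_estimator ghat) :
  f_similarity (power_probability Pplus n) (power_probability Pminus n)
    (characteristic_function m mu Xp h1 h2 p l)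
  <= ereal_sup [set expected_risk l P ghat - min_risk l P | P in PP].
Proof.
(* A space carrying a probability is nonempty, so any prediction function supplies a point of [Y],
   used as default value of the extended atoms on [Xp 0]. *)
have [x0 _] : [set: X] !=set0.
  apply/set0P/eqP => XT; have : mu setT = 1 by exact: probability_setT.
  by rewrite XT measure0 => /eqP; rewrite eq_sym onee_eq0.
have [g0 _ _] := hmin [ffun=> true]; pose y0 := g0 x0.
pose Ps b := if b then Pplus else Pminus.
have hPs b : representative Xp h1 h2 p P0 b (Ps b) by case: b.
rewrite (f_similarity_block_function hphi hm hcube hmin y0 hP0 hPs).
have key s j := representative_le_block_risk hl hphi hm hcube hmin y0 hP0 hPs
  s j hghat.
set T := integral _ _ _.
rewrite -/T in key.
set E := ereal_sup _.
pose a (j : 'I_m) s := \int[power_probability (P_ s) n]_v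
  block_risk l mu (atom1 Xp h1 y0) (atom2 Xp h2 y0) (weight Xp p) ghat
    (Xp j.+1) (s j) v.
have a0 j s : 0 <= a j s by apply: integral_ge0 => v _; exact: block_risk_ge0.
have aE s : \sum_(j < m) a j s <= E.
  apply: le_trans (expected_risk_ge hl hphi hcube y0 (hPP _ (hP_ s)) (hmin s)
    hghat) _.
  by apply: ereal_sup_ubound; exists (P_ s).
have E0 : 0 <= E by apply: le_trans (aE [ffun=> true]); exact: sume_ge0.
(* When the supremum is finite it dominates every block term, so all of them, and with them [T], are
   finite; the averaging can then take place among real numbers. *)
have [->|Efin] := eqVneq E +oo; first exact: leey.
have {}Efin : E \is a fin_num by rewrite ge0_fin_numE// ltey.
have afin j s : a j s \is a fin_num.
  rewrite ge0_fin_numE//; apply: le_lt_trans (_ : _ <= E) _; last first.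
    by rewrite ltey_eq Efin.
  apply: le_trans (aE s); rewrite (bigD1 j)//= leeDl//.
  by apply: sume_ge0 => i _.
have Ta s j : T <= a j (upd s j false) + a j (upd s j true).
  by have := key s j; rewrite /a !ffunE eqxx.
have T0 : 0 <= T by apply: integral_ge0 => v _; exact: block_function_ge0.
have Tfin : T \is a fin_num.
  rewrite ge0_fin_numE//; apply: le_lt_trans (Ta [ffun=> true] (Ordinal hm)) _.
  by rewrite ltey_eq fin_numD !afin.
(* Averaging bounds the sum over all blocks by a single excess risk; half of this inequality is the
   claim. *)
have avg : (m%:R * fine T <= 2 * fine E)%R.
  apply: (@flip_averaging _ _ (fun j s => fine (a j s))) => [s|s j].
    rewrite -lee_fin (fineK Efin) -sumEFin.
    by under eq_bigr do rewrite fineK//.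
  by rewrite -lee_fin EFinD !fineK.
rewrite -(fineK Tfin) -(fineK Efin) -EFinM lee_fin.
lra.
Qed.
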